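(* Let $N\ge 1$, $p>2$, let $u_0$ satisfy $u_0\in W^{1,\infty}(\mathbb{R}^N)$, $u_0\ge 0$, $u_0\not\equiv 0$ and $\mathrm{supp}(u_0)\subset B(0,R_0)$ for some $R_0>0$, and let $u$ be the solution of the Cauchy problem $$\partial_t u-\Delta_p u+|\nabla u|^{p-1}=0 \ \text{ in } (0,\infty)\times\mathbb{R}^N,\qquad u(0,\cdot)=u_0 \ \text{ in } \mathbb{R}^N .$$ Let $\mathcal{P}_u(t):=\{x\in\mathbb{R}^N : u(t,x)>0\}$ and $\gamma(t):=\sup\{|x| : x\in\mathcal{P}_u(t)\}$. Then $$\lim_{t\to\infty}\frac{\gamma(t)}{\log t}=\frac{1}{p-2}.$$ Moreover, the free boundary of $u$ has the same speed of expansion in any given direction: for every $\omega\in\mathbb{R}^N$ with $|\omega|=1$, $$\lim_{t\to\infty}\frac{\sup\{r\ge 0 : r\omega\in\mathcal{P}_u(t)\}}{\log t}=\frac{1}{p-2}.$$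
   Context: $\Delta_p u:=\mathrm{div}(|\nabla u|^{p-2}\nabla u)$ is the $p$-Laplacian and $B(0,R)$ is the ball of radius $R$ centred at $0$ in $\mathbb{R}^N$. By the solution of the Cauchy problem is meant its unique non-negative viscosity solution $u\in\mathcal{BC}([0,\infty)\times\mathbb{R}^N)\cap L^\infty(0,\infty;W^{1,\infty}(\mathbb{R}^N))$, where $\mathcal{BC}$ denotes bounded continuous functions (existence and uniqueness are known); $u(t)$ has compact support for every $t\geq 0$. *)

(* Defs.v *)
From HB Require Import structures.
From mathcomp Require Import all_boot all_order all_algebra.
From mathcomp Require Import all_classical all_reals all_analysis.

Set Implicit Arguments.
Unset Strict Implicit.
Unset Printing Implicit Defensive.

Import Order.TTheory GRing.Theory Num.Theory.
Import numFieldNormedType.Exports.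

Local Open Scope classical_set_scope.
Local Open Scope ring_scope.

(* The library gives [N.-tuple R] its product sigma-algebra (the Borel one) but
   no measure. The Lebesgue measure on R^N is obtained from the one on R by
   iterating the binary product. *)

Lemma product_sigma_finite d1 d2 (T1 : measurableType d1)
    (T2 : measurableType d2) (R : realType)
    (m1 : {sigma_finite_measure set T1 -> \bar R})
    (m2 : {sigma_finite_measure set T2 -> \bar R}) :
  sigma_finite setT (m1 \x m2)%E.
Proof.
have /sigma_finiteP[F [TF ndF Foo]] := sigma_finiteT m1.
have /sigma_finiteP[G [TG ndG Goo]] := sigma_finiteT m2.
exists (fun n => F n `*` G n).
  rewrite -setXTT TF TG predeqE => -[x y]; split.
    move=> [/= [n _ Fnx] [k _ Gky]]; exists (maxn n k) => //; split.
    - by move: x Fnx; exact/subsetPset/ndF/leq_maxl.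
    - by move: y Gky; exact/subsetPset/ndG/leq_maxr.
  by move=> [n _ []/= ? ?]; split; exists n.
move=> k; have [? ?] := Foo k; have [? ?] := Goo k.
split; first exact: measurableX.
by rewrite product_measure1E// lte_mul_pinfty// ge0_fin_numE.
Qed.

Section lebesgue_Rn_def.
Context {R : realType}.
Local Notation mR := (measurableTypeR R).

Definition tuple_cons n (z : mR * n.-tuple mR) : n.+1.-tuple mR :=
  [tuple of z.1 :: z.2].

Lemma measurable_tuple_cons n : measurable_fun setT (@tuple_cons n).
Proof. exact: measurable_cons. Qed.

Definition tuple_uncons n (t : n.+1.-tuple mR) : mR * n.-tuple mR :=
  (thead t, [tuple of behead t]).

Lemma measurable_tuple_uncons n : measurable_fun setT (@tuple_uncons n).
Proof.
apply: measurable_fun_pair; first exact: (measurable_tnth ord0).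
exact: measurable_behead.
Qed.

Lemma tuple_consK n : cancel (@tuple_cons n) (@tuple_uncons n).
Proof. by move=> [x t]; congr (_, _); apply: val_inj. Qed.

Section step.
Context (n : nat).
Variable m : {sigma_finite_measure set (n.-tuple mR) -> \bar R}.

Definition lebesgue_step (A : set (n.+1.-tuple mR)) : \bar R :=
  (@lebesgue_measure R \x m)%E (@tuple_cons n @^-1` A).

Let pre (A : set (n.+1.-tuple mR)) : measurable A ->
  measurable (@tuple_cons n @^-1` A).
Proof.
by move=> mA; rewrite -[X in measurable X]setTI; exact: measurable_tuple_cons.
Qed.

Let step0 : lebesgue_step set0 = 0%E.
Proof. by rewrite /lebesgue_step preimage_set0 measure0. Qed.

Let step_ge0 A : (0 <= lebesgue_step A)%E.
Proof. exact: measure_ge0. Qed.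

Let step_sigma_additive : semi_sigma_additive lebesgue_step.
Proof.
move=> F mF tF mUF; rewrite /lebesgue_step preimage_bigcup.
apply: measure_semi_sigma_additive.
- by move=> k; apply: pre; exact: mF.
- apply/trivIsetP => /= i j _ _ ij; rewrite -preimage_setI.
  by move/trivIsetP : tF => /(_ _ _ _ _ ij) ->//; rewrite preimage_set0.
- by rewrite -preimage_bigcup; exact: pre.
Qed.

HB.instance Definition _ := isMeasure.Build _ _ _ lebesgue_step
  step0 step_ge0 step_sigma_additive.

Let step_sigma_finite : sigma_finite setT lebesgue_step.
Proof.
have [F FT mF] := product_sigma_finite (@lebesgue_measure R) m.
exists (fun k => @tuple_uncons n @^-1` F k) => [|k].
  by rewrite -preimage_bigcup -FT preimage_setT.
have [mFk Fk] := mF k; split.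
  by rewrite -[X in measurable X]setTI; exact: measurable_tuple_uncons.
rewrite /lebesgue_step -comp_preimage.
rewrite (_ : _ \o _ = id) ?preimage_id//.
by apply/funext => z /=; rewrite tuple_consK.
Qed.

HB.instance Definition _ := Measure_isSigmaFinite.Build _ _ _ lebesgue_step
  step_sigma_finite.

End step.

Fixpoint lebesgue_Rn (n : nat) :
    {sigma_finite_measure set (n.-tuple mR) -> \bar R} :=
  match n with
  | 0 => \d_([tuple] : 0.-tuple mR)
  | n.+1 => lebesgue_step (lebesgue_Rn n)
  end.

End lebesgue_Rn_def.
Arguments lebesgue_Rn R n : clear implicits.

Section calculus.
Context {R : realType} {N : nat}.
Implicit Types (f g : 'rV[R]_N -> R) (F : 'rV[R]_N -> 'rV[R]_N).

(* Euclidean norm; the norm [`|x|] of the library on ['rV[R]_N] is the sup norm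
   (they induce the same topology). *)
Definition enorm (x : 'rV[R]_N) : R := Num.sqrt (\sum_i x ord0 i ^+ 2).

Definition partial (i : 'I_N) f (x : 'rV[R]_N) : R := 'D_(delta_mx ord0 i) f x.

Definition grad f (x : 'rV[R]_N) : 'rV[R]_N := \row_i partial i f x.

Definition divergence F (x : 'rV[R]_N) : R :=
  \sum_i partial i (fun y => F y ord0 i) x.

(* The field |grad f|^(p-2) grad f is C^1 where f is C^2, also at the critical
   points of f, since p > 2; there [0 `^ (p - 2) = 0]. *)
Definition pLaplacian (p : R) f (x : 'rV[R]_N) : R :=
  divergence (fun y => enorm (grad f y) `^ (p - 2) *: grad f y) x.

Definition supp f : set 'rV[R]_N := closure [set x | f x != 0].

End calculus.

Section sobolev.
Context {R : realType} {N : nat}.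
Implicit Types f g : 'rV[R]_N -> R.
Local Notation mu := (lebesgue_Rn R N).

Definition row_of_tuple (t : N.-tuple (measurableTypeR R)) : 'rV[R]_N :=
  \row_i tnth t i.

Definition smooth f := forall s : seq 'I_N,
  let h := foldr partial f s in
  continuous h /\ forall i x, derivable h x (delta_mx ord0 i).

Definition test_function f := smooth f /\ compact (supp f).

Definition weak_partial (i : 'I_N) f g := forall phi, test_function phi ->
  \int[mu]_t (f (row_of_tuple t) * partial i phi (row_of_tuple t)) =
  - \int[mu]_t (g (row_of_tuple t) * phi (row_of_tuple t)).

Definition Linfty_le f (M : R) :=
  measurable_fun setT (f \o row_of_tuple) /\
  ('N[mu]_+oo [EFin \o f \o row_of_tuple] <= M%:E)%E.

(* The norm of W^{1,oo}(R^N) is taken to be max(|f|_oo, max_i |d_i f|_oo). *)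
Definition W1infty_le f (M : R) :=
  Linfty_le f M /\
  forall i, exists g, Linfty_le g M /\ weak_partial i f g.

Definition W1infty f := exists M, W1infty_le f M.

End sobolev.

Section viscosity.
Context {R : realType} {N : nat}.
Implicit Types (u phi : R -> 'rV[R]_N -> R) (t : R) (x : 'rV[R]_N).

Definition dt phi t x : R := derive1 (phi^~ x) t.

(* phi is C^1 in time and C^2 in space, jointly in (t, x), around (t0, x0). *)
Definition C12_near phi t0 x0 := \forall z \near (t0, x0),
  [/\ derivable (phi^~ z.2) z.1 1
      /\ {for z, continuous (fun w : R * 'rV[R]_N => dt phi w.1 w.2)},
      forall i, derivable (phi z.1) z.2 (delta_mx ord0 i)
      /\ {for z, continuous (fun w => partial i (phi w.1) w.2)} &
      forall i j, derivable (partial i (phi z.1)) z.2 (delta_mx ord0 j)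
      /\ {for z, continuous (fun w => partial j (partial i (phi w.1)) w.2)}].

Definition pde (p : R) phi t x : R :=
  dt phi t x - pLaplacian p (phi t) x + enorm (grad (phi t) x) `^ (p - 1).

Definition viscosity_subsolution (p : R) u := forall phi t0 x0, 0 < t0 ->
  C12_near phi t0 x0 ->
  (\forall z \near (t0, x0),
     u z.1 z.2 - phi z.1 z.2 <= u t0 x0 - phi t0 x0) ->
  pde p phi t0 x0 <= 0.

Definition viscosity_supersolution (p : R) u := forall phi t0 x0, 0 < t0 ->
  C12_near phi t0 x0 ->
  (\forall z \near (t0, x0),
     u t0 x0 - phi t0 x0 <= u z.1 z.2 - phi z.1 z.2) ->
  0 <= pde p phi t0 x0.

Definition bounded_continuous u :=
  {within [set z : R * 'rV[R]_N | 0 <= z.1],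
    continuous (fun z => u z.1 z.2)} /\
  exists M, forall t x, 0 <= t -> `|u t x| <= M.

Definition Linfty_W1infty u := exists M,
  {ae (@lebesgue_measure R), forall t, 0 < t -> W1infty_le (u t) M}.

(* u is only constrained at times t >= 0. *)
Definition cauchy_solution (p : R) (u0 : 'rV[R]_N -> R) u :=
  [/\ bounded_continuous u /\ Linfty_W1infty u,
      forall t x, 0 <= t -> 0 <= u t x,
      viscosity_subsolution p u /\ viscosity_supersolution p u &
      u 0 = u0].

Definition positivity_set u t : set 'rV[R]_N := [set x | 0 < u t x].

(* [sup] is 0 on sets that are empty or unbounded: a positive limit of
   gamma t / ln t entails that the set is nonempty and bounded for t large. *)
Definition gamma u t : R := sup [set enorm x | x in positivity_set u t].

Definition gamma_dir u (w : 'rV[R]_N) t : R :=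
  sup [set r | 0 <= r /\ positivity_set u t (r *: w)].

End viscosity.

(* Main.v *)
Require Import Defs.
From mathcomp Require Import all_boot all_order all_algebra.
From mathcomp Require Import all_classical all_reals all_analysis.
From mathcomp Require Import ring lra.

Import Order.TTheory GRing.Theory Num.Theory.
Import numFieldNormedType.Exports.

Local Open Scope classical_set_scope.
Local Open Scope ring_scope.

Set Implicit Arguments.
Unset Strict Implicit.
Unset Printing Implicit Defensive.

(** Let [k = 1 / (p - 2)]. In dimension 1 the equation has the explicit solution
    [C * t ^ (- k) * (k * ln t - x)_+ ^ (1 + k)]. Its amplitude [t ^ (- k)]
    comes from the homogeneity of degree [p - 1] of the diffusion and of the
    absorption, and its front moves at the constant speed [k] in the time scale
    [ln t]. The speed of the free boundary is [k] because [u] can be squeezed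
    between radial functions [t ^ (- k) * G (c * ln t + A + sg * |x - x1|)] of
    the same shape, with [c = lam * k], where [lam] is close to [1]: above it if
    [lam > 1] and below it if [lam < 1] ([barrier]). The gap between [lam] and
    [1] pays for the lower-order terms: the curvature of the spheres around [x1]
    and the modification of the profile [h y = y_+], where [G] is proportional
    to [h ^ (1 + k)], into one that can be compared with [u].

    Barriers are explicit, so that no general comparison principle is needed
    between two viscosity solutions. At a point where [u] touches a barrier, the
    barrier is replaced by a paraboloid that also touches [u], and the definition
    of viscosity solutions is applied to this paraboloid ([comparison],
    [radial_jet], [flat_jet]). What remains to check is an inequality between
    [h], its slope and its second derivative ([radial_equation]).

    From above, the barrier increases away from its center and vanishes in a ball
    that shrinks at speed [c] in the time scale [ln t] ([upper_barrier]). Its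
    profile is [h y = y - d * ln (1 + y / d)], which is smooth enough at the
    front. The barrier is used twice: centered at a far point, it shows crudely
    that the support remains bounded on bounded time intervals
    ([finite_propagation]); then, its center being sent to infinity, its front
    becomes a hyperplane that [u] never crosses ([support_growth]).

    From below, the barrier is supported in a ball that expands at speed [c], and
    its profile is [h y = y - y ^ 2 / (2 * L)] up to its maximum, and constant
    beyond ([lower_barrier]). As [u >= 0], it can only touch [u] where it is
    positive, so that its front needs no care. It is also used twice: with a
    small speed it makes [u] positive, in the long run, on any given ball
    ([positivity_reaches_ball]); once such a ball is large enough for the
    curvature to be negligible, it gives any speed less than [k]
    ([positivity_growth]). *)

(** * The Euclidean norm *)

Section euclidean.
Context {R : realType} {N : nat}.
Implicit Types x y b : 'rV[R]_N.

Definition dot x y : R := \sum_i x ord0 i * y ord0 i.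

Lemma dotC x y : dot x y = dot y x.
Proof. by apply: eq_bigr => i _; rewrite mulrC. Qed.

Lemma dotDr x y z : dot x (y + z) = dot x y + dot x z.
Proof. by rewrite -big_split; apply: eq_bigr => i _; rewrite mxE mulrDr. Qed.

Lemma dotZr a x y : dot x (a *: y) = a * dot x y.
Proof.
by rewrite /dot mulr_sumr; apply: eq_bigr => i _; rewrite mxE mulrCA.
Qed.

Lemma dotNr x y : dot x (- y) = - dot x y.
Proof. by rewrite -scaleN1r dotZr mulN1r. Qed.

Lemma dotDl x y z : dot (x + y) z = dot x z + dot y z.
Proof. by rewrite dotC dotDr !(dotC z). Qed.

Lemma dotZl a x y : dot (a *: x) y = a * dot x y.
Proof. by rewrite dotC dotZr dotC. Qed.

Lemma dotNl x y : dot (- x) y = - dot x y.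
Proof. by rewrite dotC dotNr dotC. Qed.

Lemma dot0r x : dot x 0 = 0.
Proof. by rewrite -(scale0r 0) dotZr mul0r. Qed.

Lemma dot_ge0 x : 0 <= dot x x.
Proof. by apply: sumr_ge0 => i _; rewrite -expr2 sqr_ge0. Qed.

Lemma enormE x : enorm x = Num.sqrt (dot x x).
Proof. by congr Num.sqrt; apply: eq_bigr => i _; rewrite expr2. Qed.

Lemma enorm_ge0 x : 0 <= enorm x.
Proof. exact: sqrtr_ge0. Qed.

Lemma sqr_enorm x : enorm x ^+ 2 = dot x x.
Proof. by rewrite enormE sqr_sqrtr// dot_ge0. Qed.

Lemma dot_delta x i : dot x (delta_mx ord0 i) = x ord0 i.
Proof.
rewrite /dot (bigD1 i)//= big1 ?addr0 => [|j ji]; rewrite mxE !eqxx.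
  by rewrite mulr1.
by rewrite (negbTE ji) mulr0.
Qed.

Lemma norm_coord_le_enorm x i : `|x ord0 i| <= enorm x.
Proof.
rewrite -(@ler_pXn2r _ 2)// ?nnegrE ?enorm_ge0// sqr_enorm real_normK ?num_real//.
rewrite /dot (bigD1 i)//= -expr2 lerDl.
by apply: sumr_ge0 => j _; rewrite -expr2 sqr_ge0.
Qed.

Lemma enorm_eq0 x : enorm x = 0 -> x = 0.
Proof.
move=> x0; apply/rowP => i; rewrite mxE; apply/eqP.
by rewrite -normr_le0 -x0 norm_coord_le_enorm.
Qed.

Lemma enorm0 : enorm (0 : 'rV[R]_N) = 0.
Proof. by rewrite enormE dot0r sqrtr0. Qed.

Lemma enormZ a x : enorm (a *: x) = `|a| * enorm x.
Proof. by rewrite !enormE dotZl dotZr mulrA -expr2 sqrtrM ?sqr_ge0// sqrtr_sqr. Qed.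

Lemma enormN x : enorm (- x) = enorm x.
Proof. by rewrite -scaleN1r enormZ normrN1 mul1r. Qed.

Lemma Cauchy_Schwarz x y : `|dot x y| <= enorm x * enorm y.
Proof.
rewrite -(@ler_pXn2r _ 2)// ?nnegrE ?mulr_ge0 ?enorm_ge0//.
rewrite real_normK ?num_real// exprMn !sqr_enorm.
have [y0|y0] := eqVneq (dot y y) 0.
  have -> : y = 0 by apply: enorm_eq0; rewrite enormE y0 sqrtr0.
  by rewrite !dot0r mulr0 expr2 mulr0.
(* The distance from [x] to the line spanned by [y] is nonnegative. *)
have := dot_ge0 (dot y y *: x - dot x y *: y).
rewrite dotDr !dotDl !dotNl !dotNr !dotZl !dotZr (dotC y x).
have : 0 < dot y y by rewrite lt0r y0 dot_ge0.
set c := dot x y; set d := dot y y; set e := dot x x => d0 ?.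
rewrite -(ler_pM2l d0); lra.
Qed.

Lemma enormD x y : enorm (x + y) <= enorm x + enorm y.
Proof.
rewrite -(@ler_pXn2r _ 2)// ?nnegrE ?addr_ge0 ?enorm_ge0// sqr_enorm.
rewrite dotDr !dotDl (dotC y x) -!sqr_enorm.
have := le_trans (ler_norm _) (Cauchy_Schwarz x y); lra.
Qed.

Lemma enorm_lip x y : `|enorm x - enorm y| <= enorm (x - y).
Proof.
rewrite ler_norml; apply/andP; split.
  have := enormD (y - x) x; rewrite subrK -(enormN (y - x)) opprB; lra.
have := enormD (x - y) y; rewrite subrK; lra.
Qed.

Lemma sup_norm_le_enorm x : `|x| <= enorm x.
Proof.
rewrite [leLHS]/Num.norm /= mx_normrE; apply: bigmax_le; first exact: enorm_ge0.
by move=> [i j] _ /=; rewrite (ord1 i) norm_coord_le_enorm.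
Qed.

Lemma enorm_le_sup_norm x : enorm x <= N%:R * `|x|.
Proof.
have xi i : `|x ord0 i| <= `|x|.
  rewrite [leRHS]/Num.norm /= mx_normrE.
  by apply/bigmax_geP; right => /=; exists (ord0, i).
rewrite -(@ler_pXn2r _ 2)// ?nnegrE ?mulr_ge0 ?enorm_ge0// sqr_enorm.
apply: (@le_trans _ _ (N%:R * `|x| ^+ 2)).
  rewrite mulr_natl -[X in _ *+ X]card_ord -sumr_const; apply: ler_sum => i _.
  by rewrite -expr2 -(real_normK (num_real _)) lerXn2r ?nnegrE.
rewrite exprMn ler_wpM2r ?sqr_ge0// -natrX ler_nat.
by case: (N) => // n; rewrite expnS leq_pmulr// expn1.
Qed.

Lemma continuous_enorm : continuous (@enorm R N).
Proof.
move=> x; apply/(@cvgrPdist_lt _ _ _ (nbhs x)) => e e0.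
have N0 : 0 < N%:R + 1 :> R by rewrite ltr_wpDl.
near=> y; apply: (le_lt_trans (enorm_lip _ _)).
apply: (le_lt_trans (enorm_le_sup_norm _)).
apply: (@le_lt_trans _ _ ((N%:R + 1) * `|x - y|)).
  by rewrite ler_wpM2r// lerDl.
rewrite -ltr_pdivlMl//; near: y; apply/nbhs_ballP.
exists ((N%:R + 1)^-1 * e) => /=; first by rewrite mulr_gt0// invr_gt0.
by move=> y; rewrite -ball_normE.
Unshelve. all: by end_near. Qed.

(** From [2 * r * s <= r ^+ 2 + s ^+ 2]. This upper bound of the distance is
    exact at [y = 0] and quadratic in [y]: it stands in for a second-order
    expansion of the norm. *)
Lemma enorm_le_quadratic x y : 0 < enorm x ->
  enorm (x + y) <= enorm x + dot x y / enorm x + dot y y / (2 * enorm x).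
Proof.
move=> x0; have := sqr_ge0 (enorm (x + y) - enorm x).
rewrite sqrrB sqr_enorm dotDr !dotDl (dotC y x) -(sqr_enorm x).
set r := enorm x in x0 *; set r' := enorm _ => h.
rewrite -(ler_pM2l (mulr_gt0 (@ltr0n R 2) x0)).
rewrite !mulrDr [2 * r * (_ / (2 * r))]mulrC divfK ?gt_eqF ?mulr_gt0//.
rewrite [2 * r * (_ / r)](_ : _ = 2 * dot x y); last by field; rewrite gt_eqF.
lra.
Qed.

End euclidean.

(** * Paraboloids as test functions *)

Section line_derivative.
Context {R : realType}.

Lemma is_derive_line (V : normedModType R) (f : V -> R) (x v : V) (df : R) :
  is_derive (0 : R) 1 (fun h : R => f (h *: v + x)) df -> is_derive x v f df.
Proof.
have e : (fun h : R => h^-1 *: ((f \o shift x) (h *: v) - f x)) =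
    (fun h : R => h^-1 *: (((fun k : R => f (k *: v + x)) \o shift 0) (h *: 1)
      - f (0 *: v + x))).
  by apply/funext => h /=; rewrite addr0 scale0r add0r [_%:A]mulr1.
by case=> d1 d2; split; [apply/derivable1P | rewrite -d2 /derive e].
Qed.

Lemma is_derive_quadratic (V : normedModType R) (f : V -> R) (x v : V) (A B : R) :
  (forall h, f (h *: v + x) = f x + h * A + h ^+ 2 * B) -> is_derive x v f A.
Proof.
move=> fE; apply: is_derive_line; rewrite (funext fE).
pose g := cst (f x) + (A \*: (id : R -> R)) + B \*: ((id : R -> R) ^+ 2).
have : is_derive (0 : R) 1 g A.
  by apply: is_derive_eq => //=; rewrite /GRing.scale /=; ring.
congr is_derive; apply/funext => h.
rewrite /g /GRing.scale_fun /= !fctE /cst /= /GRing.scale /=; ring.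
Qed.

End line_derivative.

Section paraboloid.
Context {R : realType} {N : nat}.
Implicit Types (x b v : 'rV[R]_N) (a K al be c t : R).

(** Derivative along a line of a component of [|b| ^ q *: b], the field under the
    divergence in the p-Laplacian. At [b = 0] the factor [enorm b `^ (q - 2)] may
    be singular, but it multiplies [0]; there, the derivative vanishes because
    [|h *: v| ^ q * h] is of order [q + 1 > 1]. *)
Lemma is_derive_flux (q : R) b v (i : 'I_N) : 0 < q ->
  is_derive (0 : R) 1 (fun h : R => enorm (h *: v + b) `^ q * (h *: v + b) ord0 i)
    (q * enorm b `^ (q - 2) * dot b v * b ord0 i + enorm b `^ q * v ord0 i).
Proof.
move=> q0; have [e0|e0] := eqVneq (enorm b) 0.
  rewrite (enorm_eq0 e0) enorm0 dotC dot0r mulr0 mul0r add0r powR0 ?gt_eqF//.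
  rewrite mul0r.
  have fE h : enorm (h *: v + 0) `^ q * (h *: v + 0) ord0 i =
      h * (enorm v `^ q * v ord0 i) * `|h| `^ q.
    by rewrite addr0 enormZ powRM ?enorm_ge0// mxE; ring.
  rewrite (funext fE).
  set C := _ `^ q * _.
  suff h0 : h^-1 *: (((fun h : R => h * C * `|h| `^ q) \o shift 0)
      (h *: 1) - 0 * C * `|0 : R| `^ q) @[h --> (0 : R)^'] --> (0 : R).
    by split; [apply/cvg_ex; exists 0 | exact/cvg_lim].
  have lim0 : (C * `|h| `^ q) @[h --> (0 : R)^'] --> (0 : R).
    rewrite -[X in _ --> X](mulr0 C); apply: cvgM; first exact: cvg_cst.
    apply/cvgr0Pnorm_lt => e epos; near=> h.
    rewrite ger0_norm ?powR_ge0// -[ltRHS](@powRr1 _ e) ?ltW//.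
    rewrite -(mulVf (lt0r_neq0 q0)) powRrM gt0_ltr_powR ?nnegrE ?powR_ge0//.
    near: h; apply/nbhs_dnbhs; apply/nbhs_normP.
    exists (e `^ q^-1) => /=; first exact: powR_gt0.
    by move=> z; rewrite /= sub0r normrN.
  apply/(cvg_trans _ lim0)/near_eq_cvg; near=> h.
  have h1 : h != 0 by near: h; exact: nbhs_dnbhs_neq.
  rewrite /= addr0 [h%:A]mulr1 !mul0r subr0 /GRing.scale /=.
  by rewrite !mulrA mulVf// mul1r.
have epos : 0 < enorm b by rewrite lt0r e0 enorm_ge0.
have d0 : 0 < dot b b by rewrite -sqr_enorm exprn_gt0.
have sqrt_powR z r : 0 <= z -> Num.sqrt z `^ r = z `^ (r / 2).
  by move=> z0; rewrite -powR12_sqrt// -powRrM mulrC.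
pose w := cst (dot b b) + ((2 * dot b v) \*: (id : R -> R)) +
  dot v v \*: ((id : R -> R) ^+ 2).
pose l := cst (b ord0 i) + v ord0 i \*: (id : R -> R).
have wE h : w h = dot (h *: v + b) (h *: v + b).
  rewrite dotDr !dotDl !dotZl !dotZr (dotC v b) /w /GRing.scale_fun /= !fctE.
  rewrite /cst /= /GRing.scale /=; ring.
have lE h : l h = (h *: v + b) ord0 i.
  by rewrite !mxE /l /GRing.scale_fun /= !fctE /cst /= /GRing.scale /= addrC mulrC.
have w0 : w 0 = dot b b by rewrite wE scale0r add0r.
have dw : is_derive (0 : R) 1 w (2 * dot b v).
  by apply: is_derive_eq => //=; rewrite /GRing.scale /=; ring.
have dl : is_derive (0 : R) 1 l (v ord0 i).
  by apply: is_derive_eq => //=; rewrite /GRing.scale /=; ring.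
have dP : is_derive (w 0) 1 (@powR R ^~ (q / 2)) (q / 2 * w 0 `^ (q / 2 - 1)).
  by apply: is_derive1_powR; rewrite w0.
have := is_deriveM (is_derive1_comp dP dw) dl.
rewrite (_ : _ * l = (fun h : R => enorm (h *: v + b) `^ q *
    (h *: v + b) ord0 i)); last first.
  by apply/funext => h; rewrite !fctE /= lE wE enormE sqrt_powR// dot_ge0.
move=> dPl; apply: (is_derive_eq dPl); rewrite lE scale0r add0r /= w0 /GRing.scale /=.
rewrite enormE !sqrt_powR ?ltW//.
rewrite (_ : (q - 2) / 2 = q / 2 - 1); last by field.
by field.
Unshelve. all: by end_near. Qed.

(** The quadratic part has only two parameters, an isotropic one and one in the
    direction of the gradient [b]: radial functions need no more. *)
Definition paraboloid c a K b al be t0 x0 t x : R :=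
  c + a * (t - t0) + K * (t - t0) ^+ 2 + (dot b (x - x0) +
  2^-1 * (al * dot (x - x0) (x - x0) + be * dot b (x - x0) ^+ 2)).

(** The value at [(t0, x0)] of the operator [pde p] on a paraboloid. In the
    Hessian, [al] counts in all [N] directions, and once more, [p - 2] times, in
    that of the gradient. *)
Definition pde_jet (p a : R) b al be : R :=
  a - enorm b `^ (p - 2) * ((N%:R + p - 2) * al + (p - 1) * be * enorm b ^+ 2)
  + enorm b `^ (p - 1).

Section derivatives.
Context (c a K : R) (b : 'rV[R]_N) (al be t0 : R) (x0 : 'rV[R]_N).
Let psi := paraboloid c a K b al be t0 x0.
Let dpsi x := b + al *: (x - x0) + (be * dot b (x - x0)) *: b.

Let dt_psi t x : is_derive t 1 (psi^~ x) (a + 2 * K * (t - t0)).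
Proof.
apply: (is_derive_quadratic (B := K)) => h.
by rewrite [_%:A]mulr1 /psi /paraboloid; ring.
Qed.

Let partial_psi i t x : is_derive x (delta_mx ord0 i) (psi t) (dpsi x ord0 i).
Proof.
apply: (is_derive_quadratic (B := 2^-1 * (al + be * b ord0 i ^+ 2))) => h.
rewrite /psi /paraboloid /dpsi -(addrA _ x); move: (x - x0) => d.
set e := delta_mx _ _.
rewrite !dotDr !dotDl !dotZl !dotZr (dotC e d) !dot_delta.
have -> : e ord0 i = 1 by rewrite /e mxE !eqxx.
by rewrite !mxE; field.
Qed.

Let dpsi_line i h x : dpsi (h *: delta_mx ord0 i + x) =
  h *: (al *: delta_mx ord0 i + (be * b ord0 i) *: b) + dpsi x.
Proof.
rewrite /dpsi -(addrA _ x); move: (x - x0) => d.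
rewrite dotDr dotZr dot_delta; set e := delta_mx _ _.
by apply/rowP => j; rewrite !mxE; ring.
Qed.

Let partial_dpsi i j x :
  is_derive x (delta_mx ord0 j) (fun y => dpsi y ord0 i)
    (al * (i == j)%:R + be * b ord0 j * b ord0 i).
Proof.
apply: (is_derive_quadratic (B := 0)) => h.
by rewrite dpsi_line !mxE eqxx /=; ring.
Qed.

Let partialE i t : partial i (psi t) = fun x => dpsi x ord0 i.
Proof. by apply/funext => x; apply: derive_val. Qed.

Let partial2E i j t : partial j (partial i (psi t)) =
  fun=> al * (i == j)%:R + be * b ord0 j * b ord0 i.
Proof. by rewrite partialE; apply/funext => x; apply: derive_val. Qed.

Let gradE t : grad (psi t) = dpsi.
Proof. by apply/funext => x; apply/rowP => i; rewrite mxE partialE. Qed.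

Lemma paraboloid_C12 t x : C12_near psi t x.
Proof.
apply: (@filterE _ (nbhs (t, x))) => -[s y] /=; split.
- split; first exact: (@ex_derive _ _ _ _ _ _ _ (dt_psi s y)).
  have -> : (fun w : R * 'rV[R]_N => dt psi w.1 w.2) =
      (fun w => a + 2 * K * (w.1 - t0)).
    by apply/funext => w; rewrite /dt derive1E; apply: derive_val.
  suff lim (F : set_system (R * 'rV[R]_N)) : Filter F ->
      w.1 @[w --> F] --> s ->
      a + 2 * K * (w.1 - t0) @[w --> F] --> a + 2 * K * (s - t0).
    by apply: lim; exact: cvg_fst.
  move=> FF Fs; apply: cvgD; first exact: cvg_cst.
  apply: cvgM; first exact: cvg_cst.
  by apply: cvgB => //; exact: cvg_cst.
- move=> i; split; first exact: (@ex_derive _ _ _ _ _ _ _ (partial_psi i s y)).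
  have -> : (fun w : R * 'rV[R]_N => partial i (psi w.1) w.2) =
      (fun w => dpsi w.2 ord0 i).
    by apply/funext => w; rewrite partialE.
  have dpsiE w : dpsi w ord0 i = b ord0 i + al * (w ord0 i - x0 ord0 i) +
      be * (\sum_k b ord0 k * (w ord0 k - x0 ord0 k)) * b ord0 i.
    by rewrite !mxE; congr (_ + _ * _ * _); apply: eq_bigr => k _; rewrite !mxE.
  rewrite /prop_for /continuous_at dpsiE.
  under eq_fun do rewrite dpsiE.
  suff lim (F : set_system (R * 'rV[R]_N)) : Filter F ->
      (forall k, (fun w : R * 'rV[R]_N => w.2 ord0 k) @ F --> y ord0 k) ->
      (fun w : R * 'rV[R]_N => b ord0 i + al * (w.2 ord0 i - x0 ord0 i) +
        be * (\sum_k b ord0 k * (w.2 ord0 k - x0 ord0 k)) * b ord0 i)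
        @ F --> b ord0 i + al * (y ord0 i - x0 ord0 i) +
        be * (\sum_k b ord0 k * (y ord0 k - x0 ord0 k)) * b ord0 i.
    apply: lim => k.
    apply: (@cvg_comp _ _ _ snd (fun M : 'rV[R]_N => M ord0 k) _ (nbhs y)).
      exact: cvg_snd.
    exact: coord_continuous.
  move=> FF Fy; have coord k : (fun w : R * 'rV[R]_N => w.2 ord0 k - x0 ord0 k) @ F -->
      y ord0 k - x0 ord0 k by apply: cvgB => //; exact: cvg_cst.
  apply: cvgD.
    apply: cvgD; first exact: cvg_cst.
    by apply: cvgM => //; exact: cvg_cst.
  apply: cvgM; last exact: cvg_cst.
  apply: cvgM; first exact: cvg_cst.
  apply: cvg_big => [|k _]; first exact: add_continuous.
  by apply: cvgM => //; exact: cvg_cst.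
- move=> i j; split.
    by rewrite partialE; exact: (@ex_derive _ _ _ _ _ _ _ (partial_dpsi i j y)).
  have -> : (fun w : R * 'rV[R]_N => partial j (partial i (psi w.1)) w.2) =
      (fun=> al * (i == j)%:R + be * b ord0 j * b ord0 i).
    by apply/funext => w; rewrite partial2E.
  exact: cvg_cst.
Qed.

Lemma pde_paraboloid (p : R) : 2 < p -> pde p psi t0 x0 = pde_jet p a b al be.
Proof.
move=> p2; have dpsi0 : dpsi x0 = b.
  by rewrite /dpsi subrr dot0r mulr0 scaler0 scale0r !addr0.
rewrite /pde /pde_jet /pLaplacian gradE dpsi0 /dt derive1E.
rewrite (@derive_val _ _ _ _ _ _ _ (dt_psi t0 x0)) subrr mulr0 addr0.
congr (_ - _ + _); rewrite /divergence.
pose q := p - 2; have q0 : 0 < q by rewrite subr_gt0.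
under eq_bigr => i _.
  rewrite /partial.
  have d : is_derive x0 (delta_mx ord0 i)
      (fun y => (enorm (dpsi y) `^ (p - 2) *: dpsi y) ord0 i)
      (q * enorm b `^ (q - 2) * dot b (al *: delta_mx ord0 i +
         (be * b ord0 i) *: b) * b ord0 i + enorm b `^ q *
         (al *: delta_mx ord0 i + (be * b ord0 i) *: b) ord0 i).
    apply: is_derive_line.
    rewrite [X in is_derive _ _ X _](_ : _ = fun h : R =>
      enorm (h *: (al *: delta_mx ord0 i + (be * b ord0 i) *: b) + b) `^ q *
      (h *: (al *: delta_mx ord0 i + (be * b ord0 i) *: b) + b) ord0 i).
      exact: is_derive_flux.
    by apply/funext => h; rewrite mxE dpsi_line dpsi0.
  rewrite (@derive_val _ _ _ _ _ _ _ d) dotDr !dotZr dot_delta -sqr_enorm !mxE !eqxx /=.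
  over.
have -> : N%:R + p - 2 = N%:R + q by rewrite /q; ring.
have -> : p - 1 = q + 1 by rewrite /q; ring.
rewrite -/q; set E := enorm b.
have sumb : \sum_i b ord0 i ^+ 2 = E ^+ 2.
  by rewrite sqr_enorm; apply: eq_bigr => i _; rewrite expr2.
have powE1 : E `^ (q - 2) * E ^+ 2 = E `^ q.
  have [->|E0] := eqVneq E 0; first by rewrite expr0n mulr0 powR0// gt_eqF.
  by rewrite -powR_mulrn ?enorm_ge0// -powRD ?E0 ?implybT// subrK.
transitivity (\sum_i ((q * E `^ (q - 2) * (al + be * E ^+ 2) + E `^ q * be) *
    b ord0 i ^+ 2 + E `^ q * al)).
  by apply: eq_bigr => i _; ring.
rewrite big_split /= -mulr_sumr sumb sumr_const card_ord -[_ *+ N]mulr_natl.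
rewrite mulrDl [q * _ * _ * _](_ : _ = q * (al + be * E ^+ 2) *
  (E `^ (q - 2) * E ^+ 2)); last by ring.
by rewrite powE1; ring.
Qed.

End derivatives.
End paraboloid.

(** * Comparison with barriers *)

Section comparison.
Context {R : realType} {N : nat}.
Implicit Types (u Phi : R -> 'rV[R]_N -> R) (sg e t : R) (x : 'rV[R]_N).

Lemma compact_cylinder t1 T (x1 : 'rV[R]_N) (rho : R) :
  compact (`[t1, T]%classic `*` [set x | `|x - x1| <= rho]).
Proof.
apply: compact_setX; first exact: segment_compact.
have -> : [set x | `|x - x1| <= rho] = closed_ball_ Num.norm x1 rho.
  by apply/seteqP; split => x; rewrite /closed_ball_/= distrC.
apply: bounded_closed_compact; last exact: closed_closed_ball_.
exists (`|x1| + rho); split; first by rewrite num_real.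
move=> M M0 x; rewrite /closed_ball_/= => xr.
rewrite -[x](subrK x1) (le_trans (ler_normD _ _))//.
by rewrite distrC; lra.
Qed.

(** Both notions of viscosity solution, tested on paraboloids only, in one
    formula: [sg = 1] for subsolutions, [sg = -1] for supersolutions. *)
Definition paraboloid_test (p sg : R) u := forall c a K b al be t0 x0, 0 < t0 ->
  (\forall z \near (t0, x0),
    sg * (u z.1 z.2 - paraboloid c a K b al be t0 x0 z.1 z.2) <=
    sg * (u t0 x0 - c)) ->
  sg * pde_jet p a b al be <= 0.

Lemma paraboloid_vertex c a K (b : 'rV[R]_N) al be t0 x0 :
  paraboloid c a K b al be t0 x0 t0 x0 = c.
Proof.
rewrite /paraboloid !subrr !dot0r; ring.
Qed.

Lemma subsolution_test p u : 2 < p ->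
  viscosity_subsolution p u -> paraboloid_test p 1 u.
Proof.
move=> p2 Hu c a K b al be t0 x0 t0_gt0 umax; rewrite mul1r.
rewrite -(pde_paraboloid c a K b al be t0 x0 p2); apply: Hu => //.
  exact: paraboloid_C12.
by apply: filterS umax => z; rewrite !mul1r paraboloid_vertex.
Qed.

Lemma supersolution_test p u : 2 < p ->
  viscosity_supersolution p u -> paraboloid_test p (-1) u.
Proof.
move=> p2 Hu c a K b al be t0 x0 t0_gt0 umin; rewrite mulN1r oppr_le0.
rewrite -(pde_paraboloid c a K b al be t0 x0 p2); apply: Hu => //.
  exact: paraboloid_C12.
by apply: filterS umin => z; rewrite !mulN1r lerN2 paraboloid_vertex.
Qed.

(** Up to an error [e] on the equation, some paraboloid touching [Phi] from
    above ([sg = 1]) or from below ([sg = -1]) is a super-, resp. subsolution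
    at its vertex. *)
Definition barrier_jet (p sg e : R) Phi t0 x0 := exists a K b al be,
  - e <= sg * pde_jet p a b al be /\
  \forall z \near (t0, x0), sg * Phi z.1 z.2 <=
    sg * paraboloid (Phi t0 x0) a K b al be t0 x0 z.1 z.2.

(** Comparison on a cylinder. If [w = sg * (u - Phi)] were positive somewhere,
    then [(T - t) * w] would have a positive maximum [m], reached in the
    interior. There [u] is touched by [Phi + sg * m / (T - t)], whose time
    derivative provides the strict inequality that the jets of [Phi] lack. *)
Lemma comparison (p sg : R) u Phi (t1 T rho : R) (x1 : 'rV[R]_N) :
  sg ^+ 2 = 1 -> 0 <= t1 -> paraboloid_test p sg u ->
  {within [set z : R * 'rV[R]_N | t1 <= z.1], continuous (fun z => u z.1 z.2)} ->
  {within [set z : R * 'rV[R]_N | t1 <= z.1], continuous (fun z => Phi z.1 z.2)} ->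
  (forall x, `|x - x1| <= rho -> sg * (u t1 x - Phi t1 x) <= 0) ->
  (forall t x, t1 <= t < T -> `|x - x1| = rho -> sg * (u t x - Phi t x) <= 0) ->
  (forall t x e, t1 < t < T -> `|x - x1| < rho -> 0 < sg * (u t x - Phi t x) ->
    0 < e -> barrier_jet p sg e Phi t x) ->
  forall t x, t1 <= t < T -> `|x - x1| <= rho -> sg * (u t x - Phi t x) <= 0.
Proof.
move=> sg2 t1_ge0 testu cu cPhi init lateral interior t x /andP[t1t tT] xr.
rewrite leNgt; apply/negP => wpos.
pose w (z : R * 'rV[R]_N) := sg * (u z.1 z.2 - Phi z.1 z.2).
pose Q := `[t1, T]%classic `*` [set x | `|x - x1| <= rho].
have Qsub : Q `<=` [set z : R * 'rV[R]_N | t1 <= z.1].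
  by move=> z [/=]; rewrite in_itv /= => /andP[].
have cw : {within Q, continuous (fun z => (T - z.1) * w z)}.
  have cuQ := continuous_subspaceW Qsub cu.
  have cPhiQ := continuous_subspaceW Qsub cPhi.
  move=> z; apply: cvgM.
    apply: cvgB; first exact: cvg_cst.
    by apply: (continuous_subspaceT (f := fst)) => y; exact: cvg_fst.
  apply: cvgM; first exact: cvg_cst.
  by apply: cvgB; [exact: cuQ|exact: cPhiQ].
have Qtx : Q (t, x) by split => //=; rewrite in_itv /= t1t ltW.
have [|[t0 x0]] := compact_EVT_max _ (@compact_cylinder t1 T x1 rho) cw.
  by exists (t, x).
rewrite inE => -[/=]; rewrite in_itv /= => /andP[t1t0 t0T] x0r max0.
set m := (T - t0) * w (t0, x0) in max0.
have m_gt0 : 0 < m.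
  apply: (lt_le_trans _ (max0 (t, x) (mem_set Qtx))).
  by rewrite mulr_gt0// subr_gt0.
have {}t0T : t0 < T.
  by rewrite lt_neqAle t0T andbT; apply: contraTneq m_gt0 => t0E;
    rewrite -leNgt /m t0E subrr mul0r.
have Tt0 : 0 < T - t0 by rewrite subr_gt0.
have w0_gt0 : 0 < w (t0, x0) by move: m_gt0; rewrite /m pmulr_rgt0.
have {}t1t0 : t1 < t0.
  rewrite lt_neqAle t1t0 andbT; apply: contraTneq w0_gt0 => t10.
  by rewrite -leNgt /w /= -t10 init.
have {}x0r : `|x0 - x1| < rho.
  rewrite lt_neqAle x0r andbT; apply: contraTneq w0_gt0 => x0r'.
  by rewrite -leNgt /w /= lateral// (ltW t1t0).
pose e := m / (T - t0) ^+ 2 / 2.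
have e_gt0 : 0 < e by rewrite !divr_gt0// exprn_gt0.
have [a [K [b [al [be [jet_ge Phi_le]]]]]] :=
  interior _ _ _ (introT andP (conj t1t0 t0T)) x0r w0_gt0 e_gt0.
have w0E : w (t0, x0) = m / (T - t0) by rewrite /m mulrAC mulfV ?mul1r ?gt_eqF.
have := testu (Phi t0 x0 + sg * (m / (T - t0))) (a + sg * (m / (T - t0) ^+ 2))
  (K + sg * (2 * m / (T - t0) ^+ 3)) b al be t0 x0 (le_lt_trans t1_ge0 t1t0).
have -> : sg * pde_jet p (a + sg * (m / (T - t0) ^+ 2)) b al be =
    sg * pde_jet p a b al be + 2 * e.
  have -> : 2 * e = sg ^+ 2 * (m / (T - t0) ^+ 2).
    by rewrite sg2 /e; field; rewrite gt_eqF.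
  by rewrite /pde_jet; ring.
move=> test; suff /test : \forall z \near (t0, x0),
  sg * (u z.1 z.2 - paraboloid (Phi t0 x0 + sg * (m / (T - t0)))
    (a + sg * (m / (T - t0) ^+ 2)) (K + sg * (2 * m / (T - t0) ^+ 3))
    b al be t0 x0 z.1 z.2) <=
  sg * (u t0 x0 - (Phi t0 x0 + sg * (m / (T - t0)))) by lra.
have -> : sg * (u t0 x0 - (Phi t0 x0 + sg * (m / (T - t0)))) = 0.
  transitivity (w (t0, x0) - sg ^+ 2 * (m / (T - t0))).
    by rewrite /w /=; ring.
  by rewrite sg2 mul1r w0E subrr.
near=> z.
have z1T : T - z.1 > (T - t0) / 2.
  rewrite (_ : T - z.1 = T - t0 - (z.1 - t0)); last by ring.
  suff : `|z.1 - t0| < (T - t0) / 2 by rewrite ltr_norml => /andP[]; lra.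
  near: z; apply/nbhs_ballP; exists ((T - t0) / 2) => /=; first exact: divr_gt0.
  by move=> [s y] [/= + _]; rewrite -ball_normE /= distrC.
have Qz : Q z.
  suff : ball (t0, x0) (Num.min (t0 - t1) (rho - `|x0 - x1|)) z.
    move=> [/= + +]; rewrite -!ball_normE /= !lt_min => /andP[zt _] /andP[_ zx].
    split => /=; first by rewrite in_itv /=; move: zt z1T; rewrite ltr_norml; lra.
    have := ler_normD (z.2 - x0) (x0 - x1); rewrite addrA subrK.
    by rewrite distrC in zx; lra.
  near: z; apply/nbhs_ballP.
  exists (Num.min (t0 - t1) (rho - `|x0 - x1|)) => //=.
  by rewrite lt_min !subr_gt0 t1t0.
have Tz : 0 < T - z.1 by rewrite (lt_trans _ z1T)// divr_gt0.
have wz : w z <= m / (T - z.1).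
  by rewrite ler_pdivlMr// mulrC; have := max0 z (mem_set Qz).
have Phiz : sg * Phi z.1 z.2 <= sg * paraboloid (Phi t0 x0) a K b al be t0 x0 z.1 z.2.
  by near: z.
have -> : sg * (u z.1 z.2 - paraboloid (Phi t0 x0 + sg * (m / (T - t0)))
    (a + sg * (m / (T - t0) ^+ 2)) (K + sg * (2 * m / (T - t0) ^+ 3))
    b al be t0 x0 z.1 z.2) =
  w z + (sg * Phi z.1 z.2 - sg * paraboloid (Phi t0 x0) a K b al be t0 x0 z.1 z.2)
  - sg ^+ 2 * m * ((T - t0)^-1 + (z.1 - t0) / (T - t0) ^+ 2 +
      2 * (z.1 - t0) ^+ 2 / (T - t0) ^+ 3).
  by rewrite /w /paraboloid; field; rewrite gt_eqF.
rewrite sg2 mul1r.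
suff : m / (T - z.1) <= m * ((T - t0)^-1 + (z.1 - t0) / (T - t0) ^+ 2 +
      2 * (z.1 - t0) ^+ 2 / (T - t0) ^+ 3) by lra.
rewrite ler_pM2l//.
have -> : (T - t0)^-1 + (z.1 - t0) / (T - t0) ^+ 2 +
      2 * (z.1 - t0) ^+ 2 / (T - t0) ^+ 3 = (T - z.1)^-1 +
   ((z.1 - t0) ^+ 2 / (T - t0) ^+ 3 / (T - z.1)) * (2 * (T - z.1) - (T - t0)).
  by field; rewrite !gt_eqF.
rewrite lerDl mulr_ge0//; last lra.
by rewrite !divr_ge0 ?sqr_ge0 ?exprn_ge0 ?(ltW Tt0) ?(ltW Tz).
Unshelve. all: by end_near. Qed.

End comparison.

(** * Touching a radial barrier by a paraboloid *)

Section expansions.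
Context {R : realType}.
Implicit Types (f df : R -> R) (x d e : R).

(** The mean value theorem integrates the first-order expansion of [df]; [f] need
    not be [C^2]. *)
Lemma Taylor2 f df x (d2 : R) :
  (\forall y \near x, is_derive (y : R) 1 f (df y)) -> is_derive x 1 df d2 ->
  forall e, 0 < e -> exists2 rho : R, 0 < rho & forall d, `|d| < rho ->
    `|f (x + d) - f x - df x * d - 2^-1 * d2 * d ^+ 2| <= e * d ^+ 2.
Proof.
move=> /nbhs_ballP[r1 /= r1_gt0 f_df] [/cvg_ex[/= l dfl]] d2E e e_gt0.
have {}d2E : l = d2 by rewrite -d2E; apply/esym/cvg_lim.
rewrite {l}d2E in dfl.
have /cvgrPdist_lt/(_ e e_gt0) := dfl.
rewrite near_withinE => /nbhs_ballP[r2 /= r2_gt0 dfd2].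
exists (Num.min r1 r2); first by rewrite lt_min r1_gt0.
have df_le d : `|d| < Num.min r1 r2 ->
    `|df (x + d) - df x - d2 * d| <= e * `|d|.
  rewrite lt_min => /andP[_ dr2].
  have [->|d0] := eqVneq d 0; first by rewrite addr0 subrr mulr0 subr0 !normr0 mulr0.
  have : ball (0 : R) r2 d by rewrite -ball_normE /= sub0r normrN.
  move=> /dfd2/(_ d0); rewrite /= [d%:A]mulr1 /GRing.scale /= => /ltW.
  rewrite -(ler_pM2r (_ : 0 < `|d|)) ?normr_gt0// -normrM.
  by rewrite mulrBl mulrAC mulVf// mul1r (addrC d) distrC.
pose g d := f (x + d) - df x * d - 2^-1 * d2 * d ^+ 2.
have dg d : `|d| < Num.min r1 r2 ->
    is_derive d 1 g (df (x + d) - df x - d2 * d).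
  rewrite lt_min => /andP[dr1 _].
  have fx : is_derive (x + d) 1 f (df (x + d)).
    by apply: f_df; rewrite -ball_normE /= opprD addNKr normrN.
  have sh : is_derive d 1 (cst x + id : R -> R) 1.
    by apply: is_derive_eq (add0r _).
  have fxd := @is_derive1_comp _ f (cst x + id) d _ _ fx sh.
  have := is_deriveB (is_deriveB fxd (is_deriveZ (df x) (is_derive_id d 1)))
    (is_deriveZ (2^-1 * d2) (is_deriveX 2 (is_derive_id d 1))).
  rewrite (_ : _ - _ = g).
    move=> h; apply: (is_derive_eq h).
    by rewrite /GRing.scale /=; field.
  by apply/funext => h; rewrite /g !fctE /GRing.scale_fun /= /GRing.scale.
have gE d : f (x + d) - f x - df x * d - 2^-1 * d2 * d ^+ 2 = g d - g 0.
  by rewrite /g !mulr0 expr0n mulr0 addr0 !subr0; ring.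
have seg a b c : `|a| < Num.min r1 r2 -> `|b| < Num.min r1 r2 ->
    a <= c <= b -> `|c| < Num.min r1 r2.
  by move=> + + /andP[]; rewrite !ltr_norml => /andP[? ?] /andP[? ?]; lra.
have mvt a b : `|a| < Num.min r1 r2 -> `|b| < Num.min r1 r2 -> a < b ->
    exists2 c, a < c < b & g b - g a = (df (x + c) - df x - d2 * c) * (b - a).
  move=> ar br ab.
  have := @MVT _ g (fun c => df (x + c) - df x - d2 * c) a b ab.
  move=> [y||c cab gba].
  - by rewrite in_itv /= => /andP[? ?]; apply/dg/(seg a b) => //; lra.
  - apply: derivable_within_continuous => y; rewrite in_itv /= => yab.
    exact/(@ex_derive _ _ _ _ _ _ _ (dg _ (seg a b _ ar br yab))).
  - by exists c; first by rewrite in_itv in cab.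
have zr : `|0 : R| < Num.min r1 r2 by rewrite normr0 lt_min r1_gt0.
move=> d dr; rewrite gE.
have dd : d ^+ 2 = `|d| * `|d| by rewrite -expr2 real_normK ?num_real.
have [d_lt0|d_gt0|->] := ltgtP d 0; last by rewrite subrr normr0 expr0n mulr0.
- have [c /andP[dc c0] gc] := mvt d 0 dr zr d_lt0.
  rewrite distrC gc normrM sub0r normrN dd mulrA ler_wpM2r//.
  apply: (le_trans (df_le _ (seg d 0 c dr zr _))); first by rewrite !ltW.
  by rewrite ler_wpM2l ?(ltW e_gt0)// !ltr0_norm//; lra.
- have [c /andP[c0 cd] gc] := mvt 0 d zr dr d_gt0.
  rewrite gc normrM subr0 dd mulrA ler_wpM2r//.
  apply: (le_trans (df_le _ (seg 0 d c zr dr _))); first by rewrite !ltW.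
  by rewrite ler_wpM2l ?(ltW e_gt0)// !gtr0_norm//; lra.
Qed.

(** In time, a first-order expansion with an error [K * d ^+ 2] is enough: the
    coefficient of [(t - t0) ^+ 2] in a paraboloid does not enter [pde_jet]. *)
Definition quadratic_at f x (d1 : R) := exists K rho : R, [/\ 0 <= K, 0 < rho &
  forall d, `|d| < rho -> `|f (x + d) - f x - d1 * d| <= K * d ^+ 2].

Lemma Taylor2_quadratic_at f df x (d2 : R) :
  (\forall y \near x, is_derive (y : R) 1 f (df y)) -> is_derive x 1 df d2 ->
  quadratic_at f x (df x).
Proof.
move=> f_df df_d2; have [rho rho0 T2] := Taylor2 f_df df_d2 ltr01.
exists (1 + `|2^-1 * d2|), rho; split => // d /T2 T2d.
rewrite mulrDl; have := ler_normD (f (x + d) - f x - df x * d -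
  2^-1 * d2 * d ^+ 2) (2^-1 * d2 * d ^+ 2).
rewrite subrK normrM [X in _ + _ * X]ger0_norm ?sqr_ge0// => h.
by apply: (le_trans h); rewrite lerD2r.
Qed.

End expansions.

Section radial_jets.
Context {R : realType} {N : nat}.
Implicit Types (P E G : R -> R) (p sg e t r : R) (x : 'rV[R]_N).

Lemma sqr1P (sg : R) : sg ^+ 2 = 1 -> sg = 1 \/ sg = -1.
Proof.
by move=> /eqP; rewrite sqrf_eq1 => /orP[/eqP->|/eqP->]; [left|right].
Qed.

Lemma near_cylinder t0 (x0 : 'rV[R]_N) (Q : R * 'rV[R]_N -> Prop) (rho : R) :
  0 < rho ->
  (forall t x, `|t - t0| < rho -> enorm (x - x0) < rho -> Q (t, x)) ->
  \forall z \near (t0, x0), Q z.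
Proof.
move=> rho0 Qr.
have N0 : 0 < N%:R + 1 :> R by rewrite ltr_wpDl.
apply/nbhs_ballP; exists (Num.min rho (rho / (N%:R + 1))) => /=.
  by rewrite lt_min rho0 divr_gt0.
move=> [t x] [/= + +]; rewrite -!ball_normE /= !lt_min => /andP[tr _] /andP[_ xr].
apply: Qr; first by rewrite distrC.
apply: (le_lt_trans (enorm_le_sup_norm _)); rewrite distrC.
apply: (@le_lt_trans _ _ ((N%:R + 1) * `|x0 - x|)).
  by rewrite ler_wpM2r// lerDl.
by rewrite mulrC -ltr_pdivlMr.
Qed.

(** The terms left over when [P * (G0 + G1 * y + B / 2 * y ^+ 2)] is expanded
    around [P0], where [y] stands for the time increment [ee] of [E], plus or
    minus the increment [w + d ^+ 2 / (2 * r)] of the distance. *)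
Lemma expansion_remainder (K P0 G0 G1 B r sg : R) : 0 <= K -> 0 < r ->
  sg ^+ 2 = 1 -> exists2 M, 0 < M & forall s d w pp RP ee RE v y : R,
    v = ee + sg * (d ^+ 2 / (2 * r)) -> y = v + sg * w ->
    `|s| <= 1 -> 0 <= d <= 1 -> `|w| <= d -> `|RP| <= K * s ^+ 2 ->
    `|RE| <= K * s ^+ 2 -> `|pp| <= K * `|s| -> `|ee| <= K * `|s| ->
    `|G0 * RP + P0 * G1 * RE + G1 * (pp * y) + 2^-1 * B * P0 * v ^+ 2 +
      B * P0 * sg * (v * w) + 2^-1 * B * (pp * y ^+ 2)|
      <= M * (s ^+ 2 + `|s| * d + d ^+ 3).
Proof.
move=> K0 r0 sg2.
have sg1 : `|sg| = 1.
  by apply/eqP; rewrite -(@eqrXn2 _ 2)// -normrX sg2 expr1n normr1.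
(* One constant bounds all coefficients, so that v and y are at most
   A * (|s| + d ^ 2) and 2 * A * (|s| + d). *)
pose A := K + 1 + (2 * r)^-1.
have ir0 : 0 < (2 * r)^-1 by rewrite invr_gt0 mulr_gt0.
have A1 : 1 <= A by rewrite /A; lra.
have KA : K <= A by rewrite /A; lra.
have iA : (2 * r)^-1 <= A by rewrite /A; lra.
exists ((`|G0| + `|P0 * G1|) * A + `|G1| * (2 * A ^+ 2) + `|2^-1 * B * P0| *
    (2 * A ^+ 2) + `|B * P0| * A + `|2^-1 * B| * (8 * A ^+ 3) + 1).
  by rewrite ltr_wpDl// !addr_ge0// !mulr_ge0// ?addr_ge0// ?exprn_ge0//; lra.
move=> s d w pp RP ee RE v y vE yE s1 /andP[d0 d1] wd RPs REs pps ees.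
set W := s ^+ 2 + `|s| * d + d ^+ 3.
have s0 := normr_ge0 s.
have s2 : s ^+ 2 = `|s| ^+ 2 by rewrite real_normK ?num_real.
have d2d : d ^+ 2 <= d by rewrite expr2 ler_piMr.
have sd0 : 0 <= `|s| * d by rewrite mulr_ge0.
have d30 : 0 <= d ^+ 3 by rewrite exprn_ge0.
have s20 : 0 <= s ^+ 2 by rewrite sqr_ge0.
have W0 : 0 <= W by rewrite /W; lra.
have A0 : 0 <= A by lra.
have vA : `|v| <= A * (`|s| + d ^+ 2).
  rewrite vE (le_trans (ler_normD _ _))// normrM sg1 mul1r mulrDr lerD//.
    by rewrite (le_trans ees)// ler_wpM2r.
  rewrite ger0_norm ?divr_ge0 ?sqr_ge0 ?mulr_ge0 ?(ltW r0)//.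
  by rewrite mulrC ler_wpM2r ?sqr_ge0.
have yA : `|y| <= 2 * A * (`|s| + d).
  rewrite yE (le_trans (ler_normD _ _))// normrM sg1 mul1r.
  have : A * d ^+ 2 <= A * d by rewrite ler_wpM2l.
  have : d <= A * d by rewrite ler_peMl.
  have : 0 <= A * `|s| by rewrite mulr_ge0.
  by lra.
have ppA : `|pp| <= A * `|s| by rewrite (le_trans pps)// ler_wpM2r.
have h1 : `|RP| <= A * W.
  by rewrite (le_trans RPs)// ler_pM//; rewrite /W; lra.
have h2 : `|RE| <= A * W.
  by rewrite (le_trans REs)// ler_pM//; rewrite /W; lra.
have h3 : `|pp * y| <= 2 * A ^+ 2 * W.
  rewrite normrM (le_trans (ler_pM _ _ ppA yA))//.
  rewrite [leLHS](_ : _ = 2 * A ^+ 2 * (`|s| ^+ 2 + `|s| * d)); last by ring.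
  by rewrite ler_wpM2l ?mulr_ge0 ?sqr_ge0// -s2 /W; lra.
have h4 : `|v ^+ 2| <= 2 * A ^+ 2 * W.
  have v2 : `|v| ^+ 2 <= (A * (`|s| + d ^+ 2)) ^+ 2.
    by rewrite lerXn2r ?nnegrE// (le_trans _ vA).
  rewrite normrX (le_trans v2)//.
  rewrite exprMn [leRHS](_ : _ = A ^+ 2 * (2 * W)); last by ring.
  rewrite ler_wpM2l ?sqr_ge0// sqrrD -s2 /W.
  have : `|s| * d ^+ 2 <= `|s| * d by rewrite ler_wpM2l.
  have : (d ^+ 2) ^+ 2 <= d ^+ 3.
    by rewrite -exprM (exprSr d 3) ler_piMr.
  by lra.
have h5 : `|v * w| <= A * W.
  rewrite normrM (le_trans (ler_pM _ _ vA wd))// -mulrA ler_wpM2l//.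
  by rewrite mulrDl -exprSr /W; lra.
have h6 : `|pp * y ^+ 2| <= 8 * A ^+ 3 * W.
  rewrite expr2 mulrA normrM (le_trans (ler_pM _ _ h3 yA))//.
  rewrite [leRHS](_ : _ = 2 * A ^+ 2 * W * (2 * A * 2)); last by ring.
  rewrite ler_wpM2l ?mulr_ge0 ?sqr_ge0// ler_wpM2l ?mulr_ge0//; lra.
have bnd (c z bd : R) : `|z| <= bd -> `|c * z| <= `|c| * bd.
  by move=> zb; rewrite normrM ler_wpM2l.
have T6 (a1 a2 a3 a4 a5 a6 b1 b2 b3 b4 b5 b6 : R) :
   `|a1| <= b1 -> `|a2| <= b2 -> `|a3| <= b3 -> `|a4| <= b4 -> `|a5| <= b5 ->
   `|a6| <= b6 -> `|a1 + a2 + a3 + a4 + a5 + a6| <= b1 + b2 + b3 + b4 + b5 + b6.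
  by move=> *; do 5 (apply: (le_trans (ler_normD _ _)); apply: lerD => //).
have n5 : `|B * P0 * sg * (v * w)| <= `|B * P0| * (A * W).
  by rewrite normrM [`|B * P0 * sg|]normrM sg1 mulr1 ler_wpM2l.
apply: (le_trans (T6 _ _ _ _ _ _ _ _ _ _ _ _ (bnd G0 _ _ h1)
  (bnd (P0 * G1) _ _ h2) (bnd G1 _ _ h3) (bnd (2^-1 * B * P0) _ _ h4) n5
  (bnd (2^-1 * B) _ _ h6))).
rewrite -subr_ge0 [X in 0 <= X](_ : _ = W)//; ring.
Qed.

(** The increments are [s] in time, [d] in space and [w] in the radial direction.
    Mixed terms are absorbed in arbitrarily few [d ^+ 2] and many [s ^+ 2], as
    only the coefficient of the former matters to the equation. *)
Lemma product_expansion (sg K P0 P1 E1 G0 G1 B r eps : R) :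
  sg ^+ 2 = 1 -> 0 <= K -> 0 < r -> 0 < eps ->
  exists C : R, exists2 rho : R, 0 < rho & forall s d w RP RE y : R,
    `|s| < rho -> 0 <= d < rho -> `|w| <= d ->
    `|RP| <= K * s ^+ 2 -> `|RE| <= K * s ^+ 2 ->
    y = E1 * s + RE + sg * (d ^+ 2 / (2 * r)) + sg * w ->
    sg * ((P0 + (P1 * s + RP)) * (G0 + G1 * y + 2^-1 * B * y ^+ 2)) <=
    sg * (P0 * G0 + (P1 * G0 + P0 * G1 * E1) * s + sg * (P0 * G1) * w +
      2^-1 * (sg * (P0 * G1) / r * d ^+ 2 + P0 * B * w ^+ 2)) +
    eps * d ^+ 2 + C * s ^+ 2.
Proof.
move=> sg2 K0 r0 eps0.
pose K' := K + `|P1| + `|E1|.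
have K'0 : 0 <= K' by rewrite !addr_ge0.
have [M M0 hM] := expansion_remainder P0 G0 G1 B K'0 r0 sg2.
exists (M + M ^+ 2 / (2 * eps)), (Num.min 1 (eps / 2 / M)).
  by rewrite lt_min ltr01; do 2 apply: divr_gt0 => //.
move=> s d w RP RE y; rewrite !lt_min => /andP[s1 _] /and3P[d0 d1 dM] wd RPs REs yE.
have KK' : K <= K' by rewrite /K' -addrA lerDl addr_ge0.
have linear (a A : R) : `|A| <= K * s ^+ 2 -> K + `|a| <= K' ->
    `|a * s + A| <= K' * `|s|.
  move=> As aK; rewrite (le_trans (ler_normD _ _))// normrM.
  apply: (@le_trans _ _ ((K + `|a|) * `|s|)); last by rewrite ler_wpM2r.
  rewrite mulrDl addrC lerD2r (le_trans As)// ler_wpM2l//.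
  by rewrite -(real_normK (num_real s)) expr2 ler_piMr// ltW.
have pK : K + `|P1| <= K' by rewrite /K' lerDl.
have eK : K + `|E1| <= K' by rewrite /K' addrAC lerDl.
have := hM s d w (P1 * s + RP) RP (E1 * s + RE) RE _ y erefl yE (ltW s1)
  (introT andP (conj d0 (ltW d1))) wd
  (le_trans RPs (ler_wpM2r (sqr_ge0 s) KK')) (le_trans REs (ler_wpM2r (sqr_ge0 s) KK'))
  (linear _ _ RPs pK) (linear _ _ REs eK).
set Rm := (X in `|X|) => Rem.
have sgRm : sg * Rm <= M * (s ^+ 2 + `|s| * d + d ^+ 3).
  apply: le_trans Rem; apply: (le_trans (ler_norm _)); rewrite normrM.
  by case: (sqr1P sg2) => ->; rewrite ?normrN normr1 mul1r.
have h1 : M * d ^+ 3 <= eps / 2 * d ^+ 2.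
  rewrite exprSr mulrA mulrAC ler_wpM2r ?sqr_ge0//.
  by rewrite mulrC -ler_pdivlMr// ltW.
(* Young's inequality for the mixed term. *)
have h2 : M * (`|s| * d) <= eps / 2 * d ^+ 2 + M ^+ 2 / (2 * eps) * s ^+ 2.
  rewrite -subr_ge0 [leRHS](_ : _ = (eps * d - M * `|s|) ^+ 2 / (2 * eps)).
    by rewrite divr_ge0 ?sqr_ge0// mulr_ge0// ltW.
  by rewrite -(real_normK (num_real s)); field; rewrite gt_eqF.
have {}sgRm : sg * Rm <= eps * d ^+ 2 + (M + M ^+ 2 / (2 * eps)) * s ^+ 2.
  apply: (le_trans sgRm); rewrite !mulrDr mulrDl.
  by clear -h1 h2; lra.
rewrite -subr_ge0 [leRHS](_ : _ =
  eps * d ^+ 2 + (M + M ^+ 2 / (2 * eps)) * s ^+ 2 - sg * Rm) ?subr_ge0//.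
rewrite /Rm yE; clear -sg2 r0 eps0.
by case: (sqr1P sg2) => ->; field; rewrite !gt_eqF.
Qed.

Lemma quadratic_homo (sg G0 G1 B a b rho : R) : `|a| <= rho -> `|b| <= rho ->
  `|B| * rho <= G1 -> sg * a <= sg * b ->
  sg * (G0 + G1 * a + 2^-1 * B * a ^+ 2) <= sg * (G0 + G1 * b + 2^-1 * B * b ^+ 2).
Proof.
move=> ar br BG ab.
rewrite -subr_ge0 [leRHS](_ : _ = (sg * b - sg * a) *
  (G1 + 2^-1 * (B * (a + b)))); last by field.
rewrite mulr_ge0 ?subr_ge0//.
have : `|B * (a + b)| <= 2 * G1.
  rewrite normrM; have := ler_wpM2l (normr_ge0 B) (ler_normD a b).
  have := ler_wpM2l (normr_ge0 B) ar; have := ler_wpM2l (normr_ge0 B) br.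
  by rewrite mulrDr; lra.
by rewrite ler_norml; lra.
Qed.

End radial_jets.

Section radial_jets_of_barriers.
Context {R : realType} {N : nat}.
Implicit Types (P E G : R -> R) (p sg e t : R) (x : 'rV[R]_N).

Definition radial P E G sg (x1 : 'rV[R]_N) t x := P t * G (E t + sg * enorm (x - x1)).

(** Jets at the points where the profile [G] is smooth and increasing. The
    second-order expansion of the distance to [x1] is replaced by the quadratic
    bound [enorm_le_quadratic], on the right side for both signs as [G]
    increases. Its cost is the factor [N + p - 2], instead of [N - 1], in front
    of the curvature [1 / r]. *)
Lemma radial_jet p sg P E G t0 (x0 x1 : 'rV[R]_N) (P1 E1 G1 G2 : R) e :
  let r := enorm (x0 - x1) in
  let y0 := E t0 + sg * r in
  let g := P t0 * G1 in
  2 < p -> sg ^+ 2 = 1 -> 0 < r -> 0 < P t0 -> 0 < G1 ->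
  quadratic_at P t0 P1 -> quadratic_at E t0 E1 ->
  (forall e, 0 < e -> exists2 rho : R, 0 < rho & forall d, `|d| < rho ->
    `|G (y0 + d) - G y0 - G1 * d - 2^-1 * G2 * d ^+ 2| <= e * d ^+ 2) ->
  0 <= sg * (P1 * G y0 + g * E1 - g `^ (p - 2) *
    ((N%:R + p - 2) * (sg * g / r) + (p - 1) * (P t0 * G2)) + g `^ (p - 1)) ->
  0 < e -> barrier_jet p sg e (radial P E G sg x1) t0 x0.
Proof.
move=> r y0 g p2 sg2 r_gt0 P0_gt0 G1_gt0 [KP [rP [KP0 rP0 hP]]]
  [KE [rE [KE0 rE0 hE]]] hG ineq e_gt0.
have sgE := sqr1P sg2.
set P0 := P t0 in P0_gt0 g ineq hP *; set G0 := G y0 in ineq *.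
have g_gt0 : 0 < g by rewrite mulr_gt0.
have N0 : 0 <= N%:R :> R by [].
pose C := g `^ (p - 2) * (N%:R + p - 2 + (p - 1) * P0).
have C0 : 0 <= C by rewrite mulr_ge0 ?powR_ge0// addr_ge0 ?mulr_ge0 ?(ltW P0_gt0)//; lra.
pose eps := e / (2 * C + 1).
have eps0 : 0 < eps by apply: divr_gt0 => //; lra.
have Ceps : 2 * C * eps <= e.
  by rewrite /eps mulrA ler_pdivrMr; [rewrite mulrDr mulr1 mulrC; lra|lra].
(* The second-order coefficients are perturbed by eps, on the favorable side,
   to absorb the errors of the expansions; C bounds the effect on the equation. *)
pose B := G2 + 2 * sg * eps.
pose K := KP + KE.
have K0 : 0 <= K by rewrite addr_ge0.
have [C' [rM rM0 hM]] := product_expansion P0 P1 E1 G0 G1 B sg2 K0 r_gt0 eps0.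
have [rG rG0 {}hG] := hG eps eps0.
pose L := K + `|E1| + 1 + (2 * r)^-1.
have ir0 : 0 < (2 * r)^-1 by rewrite invr_gt0 mulr_gt0.
have L0 : 0 < L by rewrite ltr_pwDr// !addr_ge0.
have B1 : 0 < `|B| + 1 by rewrite ltr_wpDl.
have K1 : 0 < K + `|P1| + 1 by rewrite ltr_wpDl// addr_ge0.
exists (P1 * G0 + g * E1), (sg * C'),
  ((sg * g / r) *: (x0 - x1)), (sg * g / r + 2 * sg * eps), (B / (P0 * G1 ^+ 2)).
have enb : enorm ((sg * g / r) *: (x0 - x1)) = g.
  rewrite enormZ -/r normrM [`|r^-1|]ger0_norm ?invr_ge0 ?(ltW r_gt0)// -mulrA mulVf ?gt_eqF//.
  rewrite mulr1 normrM (ger0_norm (ltW g_gt0)).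
  by case: sgE => ->; rewrite ?normrN normr1 mul1r.
split.
  rewrite /pde_jet enb.
  have -> : (p - 1) * (B / (P0 * G1 ^+ 2)) * g ^+ 2 = (p - 1) * (P0 * B).
    by rewrite /g; field; rewrite !gt_eqF.
  set X := sg * _ in ineq.
  rewrite [leRHS](_ : _ = X - sg ^+ 2 * (2 * C * eps)).
    by rewrite sg2 mul1r; clear -ineq Ceps; lra.
  by rewrite /X /C /B -/P0; ring.
pose rho := Num.min (Num.min (Num.min 1 rP) (Num.min rE (rG / 2 / L)))
  (Num.min (Num.min (G1 / (`|B| + 1) / L) rM) (P0 / (K + `|P1| + 1))).
have rho0 : 0 < rho.
  have p1 : 0 < rG / 2 / L by do 2 apply: divr_gt0 => //.
  have pp2 : 0 < G1 / (`|B| + 1) / L by do 2 apply: divr_gt0 => //.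
  have p4 : 0 < P0 / (K + `|P1| + 1) by rewrite divr_gt0.
  by rewrite /rho !lt_min ltr01 rP0 rE0 p1 pp2 rM0 p4.
have : rho <= rho by []; rewrite {2}/rho !le_min -!andbA.
move=> /and5P[rho1 rhoP rhoE rhoG /and3P[rhoB rhoM rhoK]].
apply: (@near_cylinder _ _ _ _ _ rho rho0) => t x st dx.
rewrite /= /radial /paraboloid -/r -/y0 -/P0 -/G0.
set s := t - t0 in st *; set D := x - x0 in dx *; set d := enorm D in dx *.
have d0 : 0 <= d := enorm_ge0 _.
have d2 : d ^+ 2 = dot D D by rewrite sqr_enorm.
pose w := dot (x0 - x1) D / r.
have wd : `|w| <= d.
  rewrite normrM [`|r^-1|]ger0_norm ?invr_ge0 ?(ltW r_gt0)// ler_pdivrMr//.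
  by rewrite mulrC; exact: Cauchy_Schwarz.
have sgn (a : R) : `|sg * a| = `|a|.
  by case: sgE => ->; rewrite ?mulN1r ?mul1r ?normrN.
have tE : t = t0 + s by rewrite /s addrC subrK.
have RPs := hP s (lt_le_trans st rhoP); rewrite -tE in RPs.
set RP := P t - P0 - P1 * s in RPs.
have REs := hE s (lt_le_trans st rhoE); rewrite -tE in REs.
set RE := E t - E t0 - E1 * s in REs.
have s2s : s ^+ 2 <= `|s|.
  by rewrite -(real_normK (num_real s)) expr2 ler_piMr// (le_trans (ltW st)).
have linear (k a A : R) : 0 <= k -> `|A| <= k * s ^+ 2 -> k <= K ->
    `|a * s + A| <= (K + `|a|) * `|s|.
  move=> k0 As kK; rewrite (le_trans (ler_normD _ _))// normrM mulrDl addrC.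
  rewrite lerD2r (le_trans As)//; apply: ler_pM => //; exact: sqr_ge0.
have KPK : KP <= K by rewrite lerDl.
have KEK : KE <= K by rewrite lerDr.
have PE : P t = P0 + (P1 * s + RP) by rewrite /RP; ring.
have EE : E t - E t0 = E1 * s + RE by rewrite /RE; ring.
(* The increment del of the argument of G is replaced by del', where the
   distance has its quadratic upper bound. *)
pose del := E t - E t0 + sg * (enorm (x - x1) - r).
pose del' := E1 * s + RE + sg * (d ^+ 2 / (2 * r)) + sg * w.
have sum_rho (a b c : R) : 0 <= a -> 0 <= b -> 0 <= c -> a * `|s| + b * d + c * d
    <= (a + b + c) * rho.
  by move=> *; rewrite !mulrDl !lerD// ler_wpM2l// ltW.
have delL : `|del| <= L * rho.
  rewrite /del (le_trans (ler_normD _ _))// sgn EE.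
  apply: (le_trans (lerD (linear KE _ _ KE0 REs KEK) (enorm_lip _ _))).
  rewrite opprB addrA subrK -/D -/d.
  have /= := sum_rho (K + `|E1|) 1 (2 * r)^-1 (addr_ge0 K0 (normr_ge0 _)) ler01 (ltW ir0).
  by apply: le_trans; rewrite mul1r lerDl mulr_ge0// ltW.
have del'L : `|del'| <= L * rho.
  rewrite /del' (le_trans (ler_normD _ _))// sgn.
  apply: (le_trans (lerD (ler_normD _ _) wd)); rewrite sgn.
  have /= := sum_rho (K + `|E1|) 1 (2 * r)^-1 (addr_ge0 K0 (normr_ge0 _)) ler01 (ltW ir0).
  apply: le_trans; rewrite mul1r [leRHS]addrAC lerD2r.
  apply: lerD; first exact: (linear KE).
  rewrite ger0_norm ?divr_ge0 ?sqr_ge0 ?mulr_ge0 ?(ltW r_gt0)// mulrC.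
  by rewrite ler_wpM2l ?(ltW ir0)// expr2 ler_piMr// (le_trans (ltW dx)).
have delG : `|del| < rG.
  apply: (le_lt_trans delL); rewrite mulrC -ltr_pdivlMr//.
  by rewrite (le_lt_trans rhoG)// ltr_pM2r ?invr_gt0// gtr_pMr// invf_lt1// ltr1n.
have q_del : sg * G (E t + sg * enorm (x - x1)) <=
    sg * (G0 + G1 * del + 2^-1 * B * del ^+ 2).
  have -> : E t + sg * enorm (x - x1) = y0 + del by rewrite /del /y0; ring.
  have := hG del delG; rewrite -sgn => /(le_trans (ler_norm _)).
  rewrite -subr_ge0 => h; rewrite -subr_ge0 (le_trans h)// le_eqVlt; apply/orP; left.
  apply/eqP; rewrite /B -/G0.
  by case: sgE => ->; field.
have del_le : sg * del <= sg * del'.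
  have := enorm_le_quadratic D r_gt0; rewrite -d2 -/r -/w => h.
  rewrite /del /del' EE.
  have xx1 : x0 - x1 + D = x - x1 by rewrite /D addrC addrA subrK.
  rewrite [leRHS](_ : _ = sg * (E1 * s + RE) + sg ^+ 2 * (w + d ^+ 2 / (2 * r)));
    last by ring.
  rewrite mulrDr [sg * (sg * _)]mulrA -expr2 sg2 !mul1r lerD2l.
  by rewrite -xx1 lerBlDl [r + (w + _)]addrA.
have BL : `|B| * (L * rho) <= G1.
  have h : rho * L * (`|B| + 1) <= G1 by rewrite -!ler_pdivlMr// mulrAC.
  apply: (le_trans _ h); rewrite mulrC (mulrC L) ler_wpM2l ?lerDl//.
  by rewrite mulr_ge0// ltW.
have q_mono := quadratic_homo G0 delL del'L BL del_le.
have Pt_ge0 : 0 <= P t.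
  have := linear KP P1 RP KP0 RPs KPK; rewrite PE ler_norml => /andP[h _].
  rewrite -lerBlDl sub0r (le_trans _ h)// lerN2.
  apply: (@le_trans _ _ ((K + `|P1|) * rho)).
    by rewrite ler_wpM2l ?addr_ge0// ltW.
  move: rhoK; rewrite ler_pdivlMr// mulrC; apply: le_trans.
  by rewrite ler_wpM2r ?(ltW rho0)// lerDl.
have main := le_trans q_del q_mono.
rewrite (mulrCA sg); apply: (le_trans (ler_wpM2l Pt_ge0 main)).
rewrite -(mulrCA sg) PE.
apply: (le_trans (hM s d w RP RE del' (lt_le_trans st rhoM)
  (introT andP (conj d0 (lt_le_trans dx rhoM))) wd _ _ erefl)).
- by rewrite (le_trans RPs)// ler_wpM2r// sqr_ge0.
- by rewrite (le_trans REs)// ler_wpM2r// sqr_ge0.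
rewrite dotZl -d2.
have -> : dot (x0 - x1) D = r * w by rewrite /w mulrC divfK// gt_eqF.
rewrite le_eqVlt; apply/orP; left; apply/eqP; rewrite /g.
by clear -r_gt0 P0_gt0 G1_gt0 sgE; case: sgE => ->; field; rewrite !gt_eqF.
Qed.

(** Jets at the points where the profile [G] is flat to second order, including
    the center [x1], where the distance is not differentiable. *)
Lemma flat_jet p sg P E G t0 (x0 x1 : 'rV[R]_N) (P1 E1 K rG : R) e :
  let y0 := E t0 + sg * enorm (x0 - x1) in
  2 < p -> sg ^+ 2 = 1 -> 0 < P t0 ->
  quadratic_at P t0 P1 -> quadratic_at E t0 E1 ->
  0 < rG -> (forall d, `|d| < rG -> sg * (G (y0 + d) - G y0) <= K * d ^+ 2) ->
  0 <= sg * (P1 * G y0) ->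
  0 < e -> barrier_jet p sg e (radial P E G sg x1) t0 x0.
Proof.
move=> y0 p2 sg2 P0_gt0 [KP [rP [KP0 rP0 hP]]] [KE [rE [KE0 rE0 hE]]] rG0 hG
  ineq e_gt0.
have sgE := sqr1P sg2.
set P0 := P t0 in P0_gt0 hP *; set G0 := G y0 in ineq hG *.
pose Lam := KE + `|E1|; pose L := Lam + 1.
have Lam0 : 0 <= Lam by rewrite addr_ge0.
have L0 : 0 < L by rewrite ltr_wpDl.
have K1 : 0 < KP + `|P1| + 1 by rewrite ltr_wpDl// addr_ge0.
exists (P1 * G0), (sg * (`|G0| * KP + 4 * P0 * `|K| * Lam ^+ 2)), 0,
  (sg * (8 * P0 * `|K|)), 0.
split.
  rewrite /pde_jet enorm0 !powR0 ?gt_eqF ?mul0r ?addr0 ?subr0 ?subr_gt0//.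
    by rewrite (le_trans _ ineq)// oppr_le0 ltW.
  by rewrite (lt_trans _ p2)// ltr1n.
pose rho := Num.min (Num.min (Num.min 1 rP) rE)
  (Num.min (rG / 2 / L) (P0 / (KP + `|P1| + 1))).
have rho0 : 0 < rho.
  have p1 : 0 < rG / 2 / L by do 2 apply: divr_gt0 => //.
  have p4 : 0 < P0 / (KP + `|P1| + 1) by rewrite divr_gt0.
  by rewrite /rho !lt_min ltr01 rP0 rE0 p1 p4.
have : rho <= rho by []; rewrite {2}/rho !le_min -!andbA.
move=> /and5P[rho1 rhoP rhoE rhoG rhoK].
apply: (@near_cylinder _ _ _ _ _ rho rho0) => t x st dx.
rewrite /= /radial /paraboloid -/y0 -/P0 -/G0.
set s := t - t0 in st *; set D := x - x0 in dx *; set d := enorm D in dx *.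
have d0 : 0 <= d := enorm_ge0 _.
have d2 : d ^+ 2 = dot D D by rewrite sqr_enorm.
have sgn (a : R) : `|sg * a| = `|a|.
  by case: sgE => ->; rewrite ?mulN1r ?mul1r ?normrN.
have tE : t = t0 + s by rewrite /s addrC subrK.
have RPs := hP s (lt_le_trans st rhoP); rewrite -tE in RPs.
set RP := P t - P0 - P1 * s in RPs.
have REs := hE s (lt_le_trans st rhoE); rewrite -tE in REs.
set RE := E t - E t0 - E1 * s in REs.
have s2s : s ^+ 2 <= `|s|.
  by rewrite -(real_normK (num_real s)) expr2 ler_piMr// (le_trans (ltW st)).
have linear (k a A : R) : 0 <= k -> `|A| <= k * s ^+ 2 ->
    `|a * s + A| <= (k + `|a|) * `|s|.
  move=> k0 As; rewrite (le_trans (ler_normD _ _))// normrM mulrDl addrC.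
  by rewrite lerD2r (le_trans As)// ler_wpM2l.
have PE : P t = P0 + (P1 * s + RP) by rewrite /RP; ring.
have EE : E t - E t0 = E1 * s + RE by rewrite /RE; ring.
pose del := E t - E t0 + sg * (enorm (x - x1) - enorm (x0 - x1)).
have del_le : `|del| <= Lam * `|s| + d.
  rewrite /del (le_trans (ler_normD _ _))// sgn EE.
  apply: (le_trans (lerD (linear KE _ _ KE0 REs) (enorm_lip _ _))).
  by rewrite opprB addrA subrK.
have delG : `|del| < rG.
  apply: (@le_lt_trans _ _ (L * rho)).
    by rewrite (le_trans del_le)// [L * rho]mulrDl mul1r lerD ?ler_wpM2l// ltW.
  rewrite mulrC -ltr_pdivlMr// (le_lt_trans rhoG)// ltr_pM2r ?invr_gt0//.
  by rewrite gtr_pMr// invf_lt1// ltr1n.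
have P_P0 : `|P t - P0| <= P0.
  rewrite PE addrC addKr (le_trans (linear KP _ _ KP0 RPs))//.
  apply: (@le_trans _ _ ((KP + `|P1|) * rho)).
    by rewrite ler_wpM2l ?addr_ge0// ltW.
  move: rhoK; rewrite ler_pdivlMr// mulrC; apply: le_trans.
  by rewrite ler_wpM2r ?(ltW rho0)// lerDl.
have Pt0 : 0 <= P t by move: P_P0; clear; rewrite ler_norml; lra.
have Pt2 : P t <= 2 * P0 by move: P_P0; clear; rewrite ler_norml; lra.
have -> : E t + sg * enorm (x - x1) = y0 + del by rewrite /del /y0; ring.
have del2 : del ^+ 2 <= 2 * (Lam ^+ 2 * s ^+ 2) + 2 * d ^+ 2.
  rewrite -(real_normK (num_real del)) -(real_normK (num_real s)).
  apply: (@le_trans _ _ ((Lam * `|s| + d) ^+ 2)).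
    by rewrite lerXn2r ?nnegrE// addr_ge0// mulr_ge0.
  rewrite -subr_ge0 [leRHS](_ : _ = (Lam * `|s| - d) ^+ 2) ?sqr_ge0//; ring.
have G_le : sg * G (y0 + del) <= sg * G0 + `|K| * (2 * (Lam ^+ 2 * s ^+ 2) + 2 * d ^+ 2).
  rewrite -lerBlDl -mulrBr (le_trans (hG del delG))//.
  apply: (@le_trans _ _ (`|K| * del ^+ 2)); last by rewrite ler_wpM2l.
  by rewrite ler_wpM2r ?sqr_ge0// ler_norm.
rewrite mulrCA (le_trans (ler_wpM2l Pt0 G_le))// mulrDr.
have h1 : P t * (`|K| * (2 * (Lam ^+ 2 * s ^+ 2) + 2 * d ^+ 2)) <=
    2 * P0 * (`|K| * (2 * (Lam ^+ 2 * s ^+ 2) + 2 * d ^+ 2)).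
  by rewrite ler_wpM2r// mulr_ge0// (le_trans (sqr_ge0 del)).
have h2 : P t * (sg * G0) <= sg * (P0 * G0 + P1 * G0 * s) + `|G0| * (KP * s ^+ 2).
  rewrite PE -lerBlDl [leLHS](_ : _ = G0 * (sg * RP)); last by ring.
  by rewrite (le_trans (ler_norm _))// normrM sgn ler_wpM2l.
apply: (le_trans (lerD h2 h1)); rewrite -d2 le_eqVlt; apply/orP; left; apply/eqP.
rewrite dotC dot0r; clear -sgE.
by case: sgE => ->; field.
Qed.

End radial_jets_of_barriers.

(** * Powers and profiles *)

Section powers.
Context {R : realType}.
Implicit Types (x y z q k n D a t : R).

(** Bernoulli's inequality for real exponents, from [ln z <= z - 1]. *)
Lemma powR_ge_tangent n z : 1 <= n -> 0 <= z -> 1 + n * (z - 1) <= z `^ n.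
Proof.
move=> n1; rewrite le_eqVlt => /predU1P[<-|z0].
  by rewrite powR0 ?gt_eqF//; lra.
have zn : z `^ n = z * z `^ (n - 1).
  by rewrite mulr_powRB1 ?(ltW z0)//; lra.
have ln1 : 1 + (n - 1) * ln z <= z `^ (n - 1).
  by rewrite /powR gt_eqF// expR_ge1Dx.
have ln2 : z - 1 <= z * ln z.
  have /le_ln1Dx : -1 < z^-1 - 1 by rewrite ltrBrDr addNr invr_gt0.
  rewrite addrC subrK lnV ?posrE// -(ler_pM2l z0) mulrBr mulfV ?gt_eqF//; lra.
rewrite zn; apply: (@le_trans _ _ (z * (1 + (n - 1) * ln z))).
  have : (n - 1) * (z - 1) <= (n - 1) * (z * ln z) by rewrite ler_wpM2l// subr_ge0.
  lra.
by rewrite ler_wpM2l// ltW.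
Qed.

Lemma powR_mul_le n z : 0 <= n -> 0 < z -> z `^ n * (1 + n * (1 - z)) <= 1.
Proof.
move=> n0 z0; rewrite -(@ler_pM2l _ (z `^ (- n))) ?powR_gt0// mulrA -powRD; last first.
  by rewrite (gt_eqF z0) implybT.
rewrite addNr powRr0 mul1r mulr1 /powR gt_eqF//.
apply: (le_trans _ (expR_ge1Dx _)); rewrite lerD2l mulNr -mulrN ler_wpM2l//.
have /le_ln1Dx : -1 < z - 1 by lra.
by rewrite (addrC 1) subrK; lra.
Qed.

Lemma continuous_norm_powR q : 0 < q -> continuous (fun x : R => `|x| `^ q).
Proof.
move=> q0 x; have [->|x0] := eqVneq x 0.
  rewrite /continuous_at normr0 powR0 ?gt_eqF//.
  apply/cvgr0Pnorm_lt => e epos; near=> h.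
  rewrite ger0_norm ?powR_ge0// -[ltRHS](@powRr1 _ e) ?ltW//.
  rewrite -(mulVf (lt0r_neq0 q0)) powRrM gt0_ltr_powR ?nnegrE ?powR_ge0//.
  near: h; apply/nbhs_normP.
  exists (e `^ q^-1) => /=; first exact: powR_gt0.
  by move=> z; rewrite /= sub0r normrN.
apply: (@continuous_comp _ _ _ (fun x : R => `|x|) (@powR R ^~ q)).
  exact: norm_continuous.
apply: differentiable_continuous; apply/derivable1_diffP.
by apply: derivable_powR; rewrite in_itv /= andbT normr_gt0.
Unshelve. all: by end_near. Qed.

Lemma is_derive_powR_shift a s0 t : 0 < t + s0 ->
  is_derive t 1 (fun t => (t + s0) `^ a) (a * (t + s0) `^ (a - 1)).
Proof.
move=> ts0.
have dP : is_derive (shift s0 t) 1 (@powR R ^~ a) (a * (t + s0) `^ (a - 1)).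
  exact: is_derive1_powR.
have := @is_derive1_comp _ _ _ t _ _ dP (is_derive_shift t 1 s0).
by rewrite mulr1.
Qed.

Lemma near_shift_gt0 s0 t : 0 < t + s0 -> \forall t' \near t, 0 < t' + s0.
Proof.
move=> ts0; apply/nbhs_normP; exists (t + s0) => // t' /=.
by rewrite ltr_norml => /andP[_]; lra.
Qed.

Lemma quadratic_at_powR a s0 t : 0 < t + s0 ->
  quadratic_at (fun t => (t + s0) `^ a) t (a * (t + s0) `^ (a - 1)).
Proof.
move=> ts0; apply: (Taylor2_quadratic_at (df := fun t => a * (t + s0) `^ (a - 1))
  (d2 := a * ((a - 1) * (t + s0) `^ (a - 1 - 1)))).
  by apply: filterS (near_shift_gt0 ts0) => t'; exact: is_derive_powR_shift.
exact: (is_deriveZ a (is_derive_powR_shift (a - 1) ts0)).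
Qed.

Lemma quadratic_at_ln (c A s0 t : R) : 0 < t + s0 ->
  quadratic_at (fun t => c * ln (t + s0) + A) t (c / (t + s0)).
Proof.
move=> ts0; apply: (Taylor2_quadratic_at (df := fun t => c / (t + s0))
  (d2 := c * (- (t + s0) ^- 2))).
  apply: filterS (near_shift_gt0 ts0) => t' t'0.
  have dln : is_derive (shift s0 t') 1 (@ln R) (t' + s0)^-1.
    exact: is_derive1_ln.
  have dl := @is_derive1_comp _ _ _ t' _ _ dln (is_derive_shift t' 1 s0).
  have := is_deriveD (is_deriveZ c dl) (is_derive_cst A t' 1).
  by rewrite addr0 mulr1.
have dV := @is_deriveV _ (shift s0) t 1 1 _ (is_derive_shift t 1 s0).
apply: (is_deriveZ c); apply: (is_derive_eq (dV _)).
  by rewrite /= gt_eqF.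
by rewrite /GRing.scale /= mulr1.
Qed.

End powers.

Section profile.
Context {R : realType}.
Implicit Types (k D y d e : R) (h dh : R -> R).

(** Normalized so that its derivative is [(D * h y) `^ k * h^`() y]: for
    [k = (p - 2)^-1], the power [p - 2] of the latter is linear in [h]. *)
Definition power_profile k D h y : R := (D * h y) `^ (1 + k) / ((1 + k) * D).

Lemma power_profile_Taylor k D h dh y (h2 : R) : 0 < k -> 0 < D -> 0 < h y ->
  (\forall z \near y, is_derive (z : R) 1 h (dh z)) -> is_derive y 1 dh h2 ->
  forall e, 0 < e -> exists2 rho : R, 0 < rho & forall d, `|d| < rho ->
    `|power_profile k D h (y + d) - power_profile k D h y
      - (D * h y) `^ k * dh y * d
      - 2^-1 * ((D * h y) `^ k * (k * dh y ^+ 2 / h y + h2)) * d ^+ 2|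
    <= e * d ^+ 2.
Proof.
move=> k0 D0 hy0 h_dh dh_h2.
have h_cont : {for y, continuous h}.
  apply: differentiable_continuous; apply/derivable1_diffP.
  exact: (@ex_derive _ _ _ _ _ _ _ (nbhs_singleton h_dh)).
have h_pos : \forall z \near y, 0 < h z.
  exact: (@cvgr_gt _ _ (nbhs y) _ _ _ h_cont _ hy0).
have dDh a z : 0 < h z -> is_derive z 1 h (dh z) ->
    is_derive z 1 (fun z => (D * h z) `^ a) (a * (D * h z) `^ (a - 1) * (D * dh z)).
  move=> hz0 dhz.
  have dp : is_derive ((D \*: h) z) 1 (@powR R ^~ a) (a * (D * h z) `^ (a - 1)).
    by apply: is_derive1_powR; rewrite /= mulr_gt0.
  exact: (@is_derive1_comp _ _ _ z _ _ dp (is_deriveZ D dhz)).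
apply: (Taylor2 (f := power_profile k D h) (df := fun z => (D * h z) `^ k * dh z)).
  near=> z.
  have hz0 : 0 < h z by near: z.
  have dhz : is_derive z 1 h (dh z) by near: z.
  have := is_deriveZ ((1 + k) * D)^-1 (dDh (1 + k) z hz0 dhz).
  rewrite (_ : _ \*: _ = power_profile k D h).
    move=> dG; apply: (is_derive_eq dG); rewrite /GRing.scale /= addrAC subrr add0r.
    by field; rewrite !gt_eqF ?addr_gt0.
  by apply/funext => v; rewrite /power_profile [RHS]mulrC.
have := is_deriveM (dDh k y hy0 (nbhs_singleton h_dh)) dh_h2.
move=> dG; apply: (is_derive_eq dG); rewrite /GRing.scale /=.
rewrite powRB ?powRr1 ?mulr_ge0 ?(ltW D0) ?(ltW hy0)//; last first.
  by rewrite (gt_eqF (mulr_gt0 D0 hy0)) implybT.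
by field; rewrite !gt_eqF.
Unshelve. all: by end_near. Qed.

Lemma continuous_power_profile k D h : 0 < k -> 0 < D -> (forall y, 0 <= h y) ->
  continuous h -> continuous (power_profile k D h).
Proof.
move=> k0 D0 h0 hc y.
have -> : power_profile k D h =
    (fun y => `|D * h y| `^ (1 + k) * ((1 + k) * D)^-1).
  by apply/funext => z; rewrite ger0_norm ?mulr_ge0 ?(ltW D0).
apply: cvgM; last exact: cvg_cst.
apply: (@continuous_comp _ _ _ (fun y => D * h y) (fun x => `|x| `^ (1 + k))).
  by apply: cvgM; [exact: cvg_cst|exact: hc].
by apply: continuous_norm_powR; rewrite addr_gt0.
Qed.

Lemma power_profile_eq0 k D (h : R -> R) y : 0 < k -> h y = 0 ->
  power_profile k D h y = 0.
Proof.
by move=> k0 h0; rewrite /power_profile h0 mulr0 powR0 ?mul0r// gt_eqF// addr_gt0.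
Qed.

Lemma power_profile_ge0 k D (h : R -> R) y : 0 < k -> 0 < D ->
  0 <= power_profile k D h y.
Proof.
by move=> k0 D0; rewrite divr_ge0 ?powR_ge0// mulr_ge0 ?addr_ge0 ?(ltW k0) ?(ltW D0).
Qed.

Lemma power_profile_gt0 k D (h : R -> R) y : 0 < k -> 0 < D -> 0 < h y ->
  0 < power_profile k D h y.
Proof.
by move=> k0 D0 h0; rewrite divr_gt0 ?powR_gt0 ?mulr_gt0// addr_gt0.
Qed.

Lemma power_profile_homo k D (h : R -> R) y z : 0 < k -> 0 < D ->
  0 <= h y -> h y <= h z -> power_profile k D h y <= power_profile k D h z.
Proof.
move=> k0 D0 h0 hyz; have kD : 0 < (1 + k) * D by rewrite mulr_gt0// addr_gt0.
rewrite ler_pM2r ?invr_gt0// ge0_ler_powR ?nnegrE ?addr_ge0 ?(ltW k0)//.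
- by rewrite mulr_ge0// ltW.
- by rewrite mulr_ge0 ?(ltW D0)// (le_trans h0).
- by rewrite ler_wpM2l// ltW.
Qed.

(** The equation for the barrier at a point where the profile is smooth. The
    powers of [t] and of [D * h] factor out because [(p - 2) * k = 1]. *)
Lemma radial_equation (N : nat) (p sg k c D r tau h dh h2 : R) :
  2 < p -> k = (p - 2)^-1 -> 0 < D -> 0 < tau -> 0 < h -> 0 < dh ->
  let P0 := tau `^ (- k) in
  let G0 := (D * h) `^ (1 + k) / ((1 + k) * D) in
  let g := P0 * ((D * h) `^ k * dh) in
  let G2 := (D * h) `^ k * (k * dh ^+ 2 / h + h2) in
  0 <= sg * (- h / (p - 1) + c * dh - D * dh `^ (p - 2) *
    ((p - 1) * (k * dh ^+ 2 + h * h2) + h * dh * ((N%:R + p - 2) * sg / r - 1))) ->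
  0 <= sg * ((- k * tau `^ (- k - 1)) * G0 + g * (c / tau) - g `^ (p - 2) *
    ((N%:R + p - 2) * (sg * g / r) + (p - 1) * (P0 * G2)) + g `^ (p - 1)).
Proof.
move=> p2 kE D0 tau0 h0 dh0 P0 G0 g G2 ineq.
have p20 : 0 < p - 2 by rewrite subr_gt0.
have k0 : 0 < k by rewrite kE invr_gt0.
have Dh0 : 0 < D * h by rewrite mulr_gt0.
have P00 : 0 < P0 by rewrite powR_gt0.
pose Z := (D * h) `^ k.
have Z0 : 0 < Z by rewrite powR_gt0.
have gE : g = P0 * (Z * dh) by [].
have g0 : 0 < g by rewrite gE !mulr_gt0.
have gp2 : g `^ (p - 2) = tau^-1 * (D * h) * dh `^ (p - 2).
  rewrite gE !powRM ?mulr_ge0 ?(ltW Z0) ?(ltW dh0) ?(ltW P00)// /P0 /Z -!powRrM.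
  rewrite mulNr kE mulVf ?gt_eqF// powRr1 ?(ltW Dh0)// powR_inv1 ?(ltW tau0)//.
  by rewrite mulrA.
have gp1 : g `^ (p - 1) = g `^ (p - 2) * g.
  rewrite mulrC -[in LHS](@mulr_powRB1 _ g) ?(ltW g0)//; last by lra.
  by congr (_ * _ `^ _); ring.
have tau1 : tau `^ (- k - 1) = P0 / tau.
  by rewrite powRB ?(gt_eqF tau0) ?implybT// powRr1// ltW.
have G0E : G0 = Z * h / (1 + k).
  rewrite /G0 addrC powRD ?(gt_eqF Dh0) ?implybT// powRr1 ?(ltW Dh0)// -/Z.
  by field; rewrite !gt_eqF// addr_gt0.
rewrite gp1 gp2 tau1 G0E /G2 gE -/Z.
set q := dh `^ (p - 2) in ineq *.
have kk : k / (1 + k) = (p - 1)^-1.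
  by rewrite kE; field; rewrite !gt_eqF//; lra.
set X := (X in 0 <= X) in ineq.
rewrite [leRHS](_ : _ = P0 / tau * Z * X).
  exact: (mulr_ge0 (mulr_ge0 (divr_ge0 (ltW P00) (ltW tau0)) (ltW Z0)) ineq).
rewrite /X (_ : - h / (p - 1) = - (h * (k / (1 + k)))); last by rewrite kk mulNr.
have k1 : 1 + k != 0 by rewrite gt_eqF// addr_gt0.
have [-> |r0] := eqVneq r 0.
  rewrite !invr0 !mulr0; field; rewrite k1 !gt_eqF//.
clear -k1 h0 tau0 r0; field; rewrite k1 r0 !gt_eqF//.
Qed.

End profile.

(** * The profile of the upper barrier *)

Section log_profile.
Context {R : realType}.
Implicit Types (y z d : R).

(** Of order [y ^+ 2] at [0], so that its powers above the first are
    [O(y ^+ 2)]; at infinity its slope tends to [1] slowly enough,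
    like [1 - d / y], for the equation to hold there. *)
Definition log_profile d y : R :=
  Num.max y 0 - d * ln (1 + Num.max y 0 / d).

Lemma log_profile_le0 d y : y <= 0 -> log_profile d y = 0.
Proof.
by move=> y0; rewrite /log_profile (max_idPr y0) mul0r addr0 ln1 mulr0 subrr.
Qed.

Lemma log_profile_gt0 d y : 0 < d -> 0 < y -> 0 < log_profile d y.
Proof.
move=> d0 y0; rewrite /log_profile (max_idPl (ltW y0)) subr_gt0.
rewrite -ltr_pdivlMl// [ltRHS]mulrC -ltr_expR lnK ?posrE ?addr_gt0 ?divr_gt0//.
by rewrite expR_gt1Dx// gt_eqF// divr_gt0.
Qed.

Lemma log_profile_ge0 d y : 0 < d -> 0 <= log_profile d y.
Proof.
move=> d0; have [/(log_profile_le0 d)->//|/(log_profile_gt0 d0)/ltW] := leP y 0.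
by [].
Qed.

Lemma log_profile_le d y : 0 < d -> 0 < y -> log_profile d y <= y * (y / (y + d)).
Proof.
move=> d0 y0; rewrite /log_profile (max_idPl (ltW y0)).
have yd : 0 < y + d by rewrite addr_gt0.
have yd1 : -1 < - (y / (y + d)).
  by rewrite ltrN2 ltr_pdivrMr// mul1r ltrDl.
have := le_ln1Dx yd1.
rewrite (_ : 1 - y / (y + d) = (1 + y / d)^-1); last first.
  by field; rewrite !gt_eqF//= addrC addr_gt0.
rewrite lnV ?posrE ?addr_gt0 ?divr_gt0// lerN2 => h.
rewrite lerBlDr -lerBlDl (le_trans _ (ler_wpM2l (ltW d0) h))//.
rewrite le_eqVlt; apply/orP; left; apply/eqP.
by field; rewrite gt_eqF.
Qed.

Lemma log_profile_ge d y : 0 < d -> 0 < y -> (y - d) / 2 <= log_profile d y.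
Proof.
move=> d0 y0; rewrite /log_profile (max_idPl (ltW y0)).
pose v := (1 + y / d) / 2.
have v0 : 0 < v by rewrite divr_gt0// addr_gt0// divr_gt0.
have lnv : ln v <= v - 1.
  have /le_ln1Dx : -1 < v - 1 by rewrite ltrBrDr addNr.
  by rewrite addrC subrK.
have ln2 : ln 2 <= 1 :> R.
  have /le_ln1Dx : -1 < 1 :> R by rewrite (lt_trans _ ltr01)// ltrN10.
  by [].
have -> : 1 + y / d = v * 2 by rewrite /v mulfVK.
rewrite lnM ?posrE//.
have : d * (ln v + ln 2) <= d * v.
  by rewrite ler_wpM2l ?(ltW d0)//; clear -lnv ln2; lra.
have -> : d * v = (y + d) / 2 by rewrite /v; field; rewrite gt_eqF.
by clear; lra.
Qed.

Lemma continuous_max0 : continuous (fun y : R => Num.max y 0).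
Proof.
move=> y; apply: (@continuous_max _ _ (id : R -> R^o) (cst 0)).
  exact: cvg_id.
exact: cvg_cst.
Qed.

Lemma continuous_log_profile d : 0 < d -> continuous (log_profile d).
Proof.
move=> d0 y; apply: cvgB; first exact: continuous_max0.
apply: cvgM; first exact: cvg_cst.
have m0 : 0 < 1 + Num.max y 0 / d.
  by rewrite ltr_pwDl// divr_ge0 ?(ltW d0)// le_max lexx orbT.
apply: (@continuous_comp _ _ _ (fun y => 1 + Num.max y 0 / d) (@ln R)).
  apply: cvgD; first exact: cvg_cst.
  by apply: cvgM; [exact: continuous_max0|exact: cvg_cst].
exact: continuous_ln.
Qed.

Lemma is_derive_log_profile d y : 0 < d -> 0 < y ->
  is_derive y 1 (log_profile d) (y / (y + d)).
Proof.
move=> d0 y0; pose f := (id : R -> R) - d \*: (@ln R \o (cst 1 + d^-1 \*: (id : R -> R))).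
apply: (@near_eq_is_derive _ _ _ f).
  near=> z; have z0 : 0 < z by near: z; exact: lt_nbhsr.
  rewrite /f /log_profile (max_idPl (ltW z0)) ?fctE /GRing.scale_fun /= ?fctE /=.
  by rewrite /GRing.scale /= /cst (mulrC z).
have di : is_derive y 1 (cst 1 + d^-1 \*: (id : R -> R)) (0 + d^-1 *: 1).
  exact: is_deriveD.
have vE : (cst 1 + d^-1 \*: (id : R -> R)) y = 1 + y / d.
  by rewrite ?fctE /GRing.scale_fun /= ?fctE /GRing.scale /= mulrC.
have v0 : 0 < (cst 1 + d^-1 \*: (id : R -> R)) y.
  by rewrite vE addr_gt0// divr_gt0.
have dl := @is_derive1_comp _ _ _ y _ _ (is_derive1_ln v0) di.
have := is_deriveB (is_derive_id y 1) (is_deriveZ d dl).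
move=> df; apply: (is_derive_eq df); rewrite vE /GRing.scale /=.
by field; rewrite !gt_eqF//= ?addr_gt0// mul1r addr_gt0.
Unshelve. all: by end_near. Qed.

Lemma is_derive_log_slope d y : 0 < d -> 0 < y ->
  is_derive y 1 (fun y => y / (y + d)) (d / (y + d) ^+ 2).
Proof.
move=> d0 y0; have yd : 0 < y + d by rewrite addr_gt0.
have dV := @is_deriveV _ (shift d) y 1 1 _ (is_derive_shift y 1 d).
have dV' : is_derive y 1 (fun y => (y + d)^-1) (- (y + d) ^- 2 *: 1).
  by apply: dV; rewrite /= gt_eqF.
have := is_deriveM (is_derive_id y 1) dV'.
move=> df; apply: (is_derive_eq df); rewrite /GRing.scale /=.
by field; rewrite gt_eqF.
Qed.

(** [W] below is [dh] to the power [p - 1]. As [h <= y * dh], everything follows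
    from two forms of Bernoulli's inequality, [1 - W <= (p - 1) * (1 - dh)] and
    [(p - 1) * (1 - dh) * W <= 1 - W], together with [y * (1 - dh) <= d]: the
    total cost [(p - 1) * d] is paid by the gap between [lam] and [th]. *)
Lemma log_profile_equation (p nu lam th d r y : R) : 2 < p -> 0 < d -> 0 < y ->
  let k := (p - 2)^-1 in let dh := y / (y + d) in
  1 <= th * (1 - nu / r) -> 0 < th -> (p - 1) * d <= (1 + k) * (lam - th) ->
  0 <= - log_profile d y / (p - 1) + lam * k * dh - th / (p - 1) * dh `^ (p - 2) *
    ((p - 1) * (k * dh ^+ 2 + log_profile d y * (d / (y + d) ^+ 2)) +
     log_profile d y * dh * (nu * 1 / r - 1)).
Proof.
move=> p2 d0 y0 k dh thmu th0 dsmall.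
have p20 : 0 < p - 2 by rewrite subr_gt0.
have p1 : 1 < p - 1 by clear -p2; lra.
have p10 : 0 < p - 1 by rewrite (lt_trans ltr01).
have k0 : 0 < k by rewrite invr_gt0.
have yd : 0 < y + d by rewrite addr_gt0.
have dh0 : 0 < dh by rewrite divr_gt0.
have hle := log_profile_le d0 y0; have h0 := log_profile_gt0 d0 y0.
set h := log_profile d y in hle h0 *; rewrite -/dh in hle.
set q := dh `^ (p - 2); pose W := dh `^ (p - 1).
have qW : q * dh = W.
  rewrite mulrC /q /W -(@mulr_powRB1 _ dh (p - 1)) ?(ltW dh0)//.
  by congr (_ * _ `^ _); ring.
have q0 : 0 < q by rewrite powR_gt0.
have W0 : 0 < W by rewrite powR_gt0.
have W1 : W * (1 + (p - 1) * (1 - dh)) <= 1 by rewrite powR_mul_le// ltW.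
have W2 : 1 + (p - 1) * (dh - 1) <= W by rewrite powR_ge_tangent ?ltW.
have dh1 : 1 - dh = d / (y + d) by rewrite /dh; field; rewrite gt_eqF.
have dh1_ge0 : 0 <= 1 - dh by rewrite dh1 ltW// divr_gt0.
have W_le1 : 0 <= 1 - W.
  have : 0 <= W * ((p - 1) * (1 - dh)) by rewrite !mulr_ge0 ?(ltW W0) ?(ltW p10).
  by clear -W1; rewrite mulrDr; lra.
have mk : (p - 1) * k = 1 + k by rewrite /k; field; rewrite gt_eqF.
have -> : d / (y + d) ^+ 2 = dh * (1 - dh) / y.
  by rewrite dh1 /dh; field; rewrite !gt_eqF.
rewrite -(pmulr_rge0 _ p10).
rewrite [leRHS](_ : _ = - h * (1 - th * W * (1 - nu / r)) + (1 + k) * lam * dh -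
   th * (W * ((1 + k) * dh + (p - 1) * (h / y) * (1 - dh)))); last first.
  rewrite -mk -qW; clear -p10 y0.
  have [->|r0] := eqVneq r 0; first by rewrite !invr0; field; rewrite !gt_eqF.
  by field; rewrite r0 !gt_eqF.
have e1 : h * (1 - th * W * (1 - nu / r)) <= y * dh * (1 - W).
  apply: (@le_trans _ _ (h * (1 - W))).
    rewrite ler_wpM2l ?(ltW h0)// lerD2l lerN2 mulrAC.
    by rewrite -[leLHS]mul1r ler_wpM2r// ltW.
  by rewrite ler_wpM2r.
have e2 : y * (1 - W) <= (p - 1) * d.
  apply: (@le_trans _ _ (y * ((p - 1) * (1 - dh)))).
    by rewrite ler_wpM2l ?(ltW y0)//; clear -W2; lra.
  rewrite dh1 mulrCA ler_wpM2l ?(ltW p10)// mulrCA ler_piMr ?(ltW d0)//.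
  by rewrite ler_pdivrMr// mul1r lerDl ltW.
have e3 : W * ((p - 1) * (h / y) * (1 - dh)) <= dh * (1 - W).
  apply: (@le_trans _ _ (W * ((p - 1) * dh * (1 - dh)))).
    rewrite ler_wpM2l ?(ltW W0)// ler_wpM2r// ler_wpM2l ?(ltW p10)//.
    by rewrite ler_pdivrMr// mulrC.
  rewrite [leLHS](_ : _ = dh * (W * ((p - 1) * (1 - dh)))); last by ring.
  by rewrite ler_wpM2l ?(ltW dh0)//; clear -W1; rewrite mulrDr in W1; lra.
have e4 : y * dh * (1 - W) <= dh * ((1 + k) * (lam - th)).
  by rewrite -mulrA mulrCA ler_wpM2l ?(ltW dh0)// (le_trans e2).
have e5 : 0 <= th * (k * (dh * (1 - W))).
  exact: (mulr_ge0 (ltW th0) (mulr_ge0 (ltW k0) (mulr_ge0 (ltW dh0) W_le1))).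
have e6 := ler_wpM2l (ltW th0) e3.
rewrite mulNr (mulrDr W) mulrDr.
move: e1 e4 e5 e6; move: (h * (1 - _)) (W * (_ * (1 - dh))) (y * dh * _) => a1 a2 a3.
by clear; lra.
Qed.

End log_profile.

(** * The profile of the lower barrier *)

Section quad_profile.
Context {R : realType}.
Implicit Types (y z L : R).

Definition quad_profile L y : R :=
  let z := Num.min (Num.max y 0) L in z - z ^+ 2 / (2 * L).

Lemma quad_profile_le0 L y : 0 < L -> y <= 0 -> quad_profile L y = 0.
Proof.
move=> L0 y0; rewrite /quad_profile (max_idPr y0) (min_idPl (ltW L0)).
by rewrite expr0n mul0r subrr.
Qed.

Lemma quad_profileE L y : 0 <= y <= L -> quad_profile L y = y - y ^+ 2 / (2 * L).
Proof.
by move=> /andP[y0 yL]; rewrite /quad_profile (max_idPl y0) (min_idPl yL).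
Qed.

Lemma quad_profile_geL L y : 0 < L -> L <= y -> quad_profile L y = L / 2.
Proof.
move=> L0 yL; rewrite /quad_profile (max_idPl (le_trans (ltW L0) yL)).
by rewrite (min_idPr yL); field; rewrite gt_eqF.
Qed.

Lemma quad_profile_gt0 L y : 0 < L -> 0 < y -> 0 < quad_profile L y.
Proof.
move=> L0 y0; rewrite /quad_profile (max_idPl (ltW y0)).
set z := Num.min y L; have z0 : 0 < z by rewrite lt_min y0.
have zL : z <= L by rewrite ge_min lexx orbT.
rewrite subr_gt0 ltr_pdivrMr ?mulr_gt0// expr2 ltr_pM2l//.
by rewrite (le_lt_trans zL)// ltr_pMl// ltr1n.
Qed.

Lemma quad_profile_ge0 L y : 0 < L -> 0 <= quad_profile L y.
Proof.
move=> L0; have [/(quad_profile_le0 L0)->//|/(quad_profile_gt0 L0)/ltW] := leP y 0.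
by [].
Qed.

(** What makes the jets flat on the plateau, including at its edge [L], where the
    second derivative jumps. *)
Lemma quad_profile_flat L y d : 0 < L -> L <= y ->
  L / 2 - quad_profile L (y + d) <= d ^+ 2 / (2 * L).
Proof.
move=> L0 Ly; rewrite /quad_profile.
set z := Num.min _ L.
have -> : L / 2 - (z - z ^+ 2 / (2 * L)) = (L - z) ^+ 2 / (2 * L).
  by field; rewrite gt_eqF.
rewrite ler_pM2r ?invr_gt0 ?mulr_gt0//.
have zL : z <= L by rewrite ge_min lexx orbT.
have Ld : L - z <= `|d|.
  rewrite lerBlDr -lerBlDl le_min le_max; apply/andP; split.
    apply/orP; left; rewrite lerBlDr (le_trans Ly)// -addrA lerDl.
    by rewrite -lerBlDl sub0r -normrN ler_norm.
  by rewrite lerBlDr lerDl.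
by rewrite -(real_normK (num_real d)) lerXn2r ?nnegrE ?subr_ge0.
Qed.

Lemma quad_profile_max L y : 0 < L -> quad_profile L y <= L / 2.
Proof.
move=> L0; rewrite /quad_profile; set z := Num.min _ L; rewrite -subr_ge0.
have -> : L / 2 - (z - z ^+ 2 / (2 * L)) = (L - z) ^+ 2 / (2 * L).
  by field; rewrite gt_eqF.
by rewrite divr_ge0 ?sqr_ge0// mulr_ge0// ltW.
Qed.

Lemma continuous_quad_profile L : 0 < L -> continuous (quad_profile L).
Proof.
move=> L0 y.
have cm : {for y, continuous (fun y => Num.min (Num.max y 0) L)}.
  apply: (@continuous_min _ _ (fun y : R => Num.max y 0 : R^o) (cst L)).
    exact: continuous_max0.
  exact: cvg_cst.
apply: cvgB; first exact: cm.
apply: cvgM; last exact: cvg_cst.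
apply: (@continuous_comp _ _ _ (fun y => Num.min (Num.max y 0) L)
  (fun z : R => z ^+ 2)) => //.
exact: exprn_continuous.
Qed.

Lemma is_derive_quad_profile L y : 0 < y < L ->
  is_derive y 1 (quad_profile L) (1 - y / L).
Proof.
move=> /andP[y0 yL]; have L0 := lt_trans y0 yL.
apply: (@near_eq_is_derive _ _ _ (fun z : R => z - z ^+ 2 / (2 * L))).
  near=> z; rewrite quad_profileE//; apply/andP; split; apply: ltW; near: z.
    exact: lt_nbhsr.
  exact: lt_nbhsl.
apply: (is_derive_quadratic (B := - (2 * L)^-1)) => h.
by rewrite [_%:A]mulr1; field; rewrite gt_eqF.
Unshelve. all: by end_near. Qed.

Lemma is_derive_quad_slope L y : is_derive y 1 (fun y => 1 - y / L) (- L^-1).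
Proof.
by apply: (is_derive_quadratic (B := 0)) => h; rewrite [_%:A]mulr1; ring.
Qed.

(** Near the front, where the slope [dh] is close to [1], the equation holds
    because [lam < th]; elsewhere [h] is comparable to [L], and the reaction
    term [h / (p - 1)], due to the decay of the amplitude, dominates. *)
Lemma quad_profile_equation (p nu lam th L r1 r y : R) : 2 < p -> 0 <= nu ->
  0 < y < L -> 0 < r1 <= r -> 0 < lam < th ->
  let k := (p - 2)^-1 in let dh := 1 - y / L in let h := quad_profile L y in
  2 * (1 + k) * (p - 1) * lam <=
    (1 - lam / th) * (L * (1 - th * (1 + nu / r1)) - th * (p - 1)) ->
  0 <= -1 * (- h / (p - 1) + lam * k * dh - th / (p - 1) * dh `^ (p - 2) *
    ((p - 1) * (k * dh ^+ 2 + h * - L^-1) +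
     h * dh * (nu * -1 / r - 1))).
Proof.
move=> p2 nu0 /andP[y0 yL] /andP[r10 r1r] /andP[lam0 lamth] k dh h cond.
have L0 := lt_trans y0 yL; have th0 := lt_trans lam0 lamth.
have r0 : 0 < r := lt_le_trans r10 r1r.
have p20 : 0 < p - 2 by rewrite subr_gt0.
have p1 : 1 < p - 1 by clear -p2; lra.
have p10 : 0 < p - 1 by rewrite (lt_trans ltr01).
have k0 : 0 < k by rewrite invr_gt0.
have yL1 : 0 < y / L < 1 by rewrite divr_gt0//= ltr_pdivrMr// mul1r.
have dh0 : 0 < dh by case/andP: yL1 => _; rewrite subr_gt0.
have dh1 : dh <= 1 by case/andP: yL1 => /ltW + _; rewrite gerBl.
have hE : h = L * (1 - dh ^+ 2) / 2.
  rewrite /h quad_profileE ?(ltW y0) ?ltW// /dh; field; rewrite gt_eqF//.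
have h0 : 0 < h by rewrite quad_profile_gt0.
set q := dh `^ (p - 2); pose W := dh `^ (p - 1).
have qW : q * dh = W.
  rewrite mulrC /q /W -(@mulr_powRB1 _ dh (p - 1)) ?(ltW dh0)//.
  by congr (_ * _ `^ _); ring.
have q0 : 0 < q by rewrite powR_gt0.
have W0 : 0 < W by rewrite powR_gt0.
have dh01 : 0 < dh <= 1 by rewrite dh0.
have q1 : q <= 1 by rewrite -(powRr0 dh) ger_powR// ltW.
have W1 : W <= 1 by rewrite -(powRr0 dh) ger_powR// ltW.
have W2 : 1 + (p - 1) * (dh - 1) <= W by rewrite powR_ge_tangent ?ltW.
have mk : (p - 1) * k = 1 + k by rewrite /k; field; rewrite gt_eqF.
set S := L * _ - _ in cond.
have lt1 : 0 < 1 - lam / th by rewrite subr_gt0 ltr_pdivrMr// mul1r.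
have m0 : 0 < 1 + k by rewrite addr_gt0.
have S0 : 0 <= S.
  rewrite -(pmulr_rge0 _ lt1) (le_trans _ cond)//.
  exact: (mulr_ge0 (mulr_ge0 (mulr_ge0 (ler0n _ 2) (ltW m0)) (ltW p10)) (ltW lam0)).
rewrite -(pmulr_rge0 _ p10).
rewrite [leRHS](_ : _ = h * (1 - th * W * (1 + nu / r) - th * q * (p - 1) / L) +
   (1 + k) * dh * (th * W - lam)); last first.
  rewrite -mk -qW; clear -p10 L0 r0; clearbody h dh.
  by field; rewrite !gt_eqF.
have a1 : h * (S / L) <= h * (1 - th * W * (1 + nu / r) - th * q * (p - 1) / L).
  rewrite ler_wpM2l ?(ltW h0)//.
  have -> : S / L = 1 - th * 1 * (1 + nu / r1) - th * 1 * (p - 1) / L.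
    by rewrite /S; field; rewrite !gt_eqF.
  apply: lerB.
    rewrite lerD2l lerN2 -!mulrA ler_wpM2l ?(ltW th0)//.
    apply: ler_pM => //; first exact: ltW.
      by rewrite addr_ge0// divr_ge0// ltW.
    by rewrite lerD2l ler_wpM2l// lef_pV2.
  by rewrite -!mulrA ler_wpM2l ?(ltW th0)// ler_wpM2r// divr_ge0// ltW.
apply: (le_trans _ (lerD a1 (lexx _))).
have [thW|thW] := leP lam (th * W).
  apply: addr_ge0; first by rewrite mulr_ge0 ?(ltW h0)// divr_ge0// ltW.
  by rewrite mulr_ge0 ?subr_ge0// mulr_ge0 ?(ltW dh0)// ltW.
have Wlt : W <= lam / th by rewrite ler_pdivlMr// mulrC ltW.
have a2 : 1 - lam / th <= (p - 1) * (1 - dh) by clear -Wlt W2; lra.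
have a3 : L * (1 - dh) / 2 <= h.
  rewrite hE ler_wpM2r// ler_wpM2l ?(ltW L0)// lerD2l lerN2.
  by rewrite expr2 ler_piMr// ltW.
have a4 : (1 + k) * lam <= h * (S / L).
  apply: (@le_trans _ _ (L * (1 - dh) / 2 * (S / L))); last first.
    by rewrite ler_wpM2r// divr_ge0// ltW.
  have -> : L * (1 - dh) / 2 * (S / L) = (1 - dh) * S / 2.
    by field; rewrite gt_eqF.
  rewrite ler_pdivlMr// -(ler_pM2l p10).
  have a5 := ler_wpM2r S0 a2.
  rewrite [leRHS]mulrA (le_trans _ a5)// (le_trans _ cond)//.
  by rewrite le_eqVlt; apply/orP; left; apply/eqP; ring.
have a6 : 0 <= (1 + k) * (lam * (1 - dh) + th * W * dh).
  have b1 : 0 <= lam * (1 - dh) by rewrite mulr_ge0 ?subr_ge0 ?(ltW lam0).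
  have b2 : 0 <= th * W * dh.
    exact: (mulr_ge0 (mulr_ge0 (ltW th0) (ltW W0)) (ltW dh0)).
  exact: (mulr_ge0 (ltW m0) (addr_ge0 b1 b2)).
move: a4 a6; move: (h * (S / L)) => Z; clear.
by lra.
Qed.

End quad_profile.

(** * Radial barriers *)

Section barriers.
Context {R : realType} {N : nat}.
Implicit Types (p sg c D A t : R) (x : 'rV[R]_N) (h dh : R -> R).

(** With [c = (p - 2)^-1], [D = (p - 1)^-1], [sg = -1] and the profile
    [h y = Num.max y 0], and with the distance to a point replaced by a coordinate
    of [x], this is the explicit travelling wave. *)
Definition barrier p c D (s0 : R) A sg h (x1 : 'rV[R]_N) :=
  radial (fun t => (t + s0) `^ (- (p - 2)^-1)) (fun t => c * ln (t + s0) + A)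
    (power_profile (p - 2)^-1 D h) sg x1.

Lemma barrier_smooth_jet p c D (s0 : R) A sg h dh (h2 : R) (x1 x0 : 'rV[R]_N) t e :
  let r := enorm (x0 - x1) in let y := c * ln (t + s0) + A + sg * r in
  2 < p -> sg ^+ 2 = 1 -> 0 < D -> 0 < t + s0 -> 0 < r -> 0 < h y -> 0 < dh y ->
  (\forall z \near y, is_derive (z : R) 1 h (dh z)) -> is_derive y 1 dh h2 ->
  0 <= sg * (- h y / (p - 1) + c * dh y - D * dh y `^ (p - 2) *
    ((p - 1) * ((p - 2)^-1 * dh y ^+ 2 + h y * h2) +
     h y * dh y * ((N%:R + p - 2) * sg / r - 1))) ->
  0 < e -> barrier_jet p sg e (barrier p c D s0 A sg h x1) t x0.
Proof.
move=> r y p2 sg2 D0 ts0 r0 hy0 dhy0 h_dh dh_h2 ineq e0.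
have k0 : 0 < (p - 2)^-1 by rewrite invr_gt0 subr_gt0.
apply: (@radial_jet _ _ _ _ _ _ _ _ _ _ (- (p - 2)^-1 * (t + s0) `^ (- (p - 2)^-1 - 1))
  (c / (t + s0)) ((D * h y) `^ (p - 2)^-1 * dh y)
  ((D * h y) `^ (p - 2)^-1 * ((p - 2)^-1 * dh y ^+ 2 / h y + h2))) => //.
- by rewrite powR_gt0.
- by rewrite mulr_gt0// powR_gt0// mulr_gt0.
- exact: quadratic_at_powR.
- exact: quadratic_at_ln.
- exact: power_profile_Taylor.
- exact: radial_equation.
Qed.

Lemma continuous_barrier p c D (s0 : R) A sg h (x1 : 'rV[R]_N) (t1 : R) :
  2 < p -> 0 < D -> 0 < t1 + s0 -> (forall y, 0 <= h y) -> continuous h ->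
  {within [set z : R * 'rV[R]_N | t1 <= z.1],
    continuous (fun z => barrier p c D s0 A sg h x1 z.1 z.2)}.
Proof.
move=> p2 D0 t1s0 h0 hc; apply: continuous_in_subspaceT => z; rewrite inE /= => t1z.
have zs0 : 0 < z.1 + s0 by rewrite (lt_le_trans t1s0)// lerD2r.
have k0 : 0 < (p - 2)^-1 by rewrite invr_gt0 subr_gt0.
have c1 : {for z, continuous (fun z : R * 'rV[R]_N => z.1 + s0)}.
  suff lim (F : set_system (R * 'rV[R]_N)) : Filter F ->
      w.1 @[w --> F] --> z.1 -> w.1 + s0 @[w --> F] --> z.1 + s0.
    by apply: lim; exact: cvg_fst.
  by move=> FF Fz; apply: cvgD => //; exact: cvg_cst.
have c2 : {for z, continuous (fun z : R * 'rV[R]_N => enorm (z.2 - x1))}.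
  apply: (@continuous_comp _ _ _ (fun z : R * 'rV[R]_N => z.2 - x1) (@enorm R N)).
    suff lim (F : set_system (R * 'rV[R]_N)) : Filter F ->
        w.2 @[w --> F] --> z.2 -> w.2 - x1 @[w --> F] --> z.2 - x1.
      by apply: lim; exact: cvg_snd.
    by move=> FF Fz; apply: cvgB => //; exact: cvg_cst.
  exact: continuous_enorm.
have c3 : {for z, continuous (fun z : R * 'rV[R]_N => (z.1 + s0) `^ (- (p - 2)^-1))}.
  apply: (@continuous_comp _ _ _ (fun z : R * 'rV[R]_N => z.1 + s0)
    (@powR R ^~ (- (p - 2)^-1))) => //.
  apply: differentiable_continuous; apply/derivable1_diffP.
  by apply: derivable_powR; rewrite in_itv /= andbT.
have c4 : {for z, continuous (fun z : R * 'rV[R]_N => ln (z.1 + s0))}.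
  apply: (@continuous_comp _ _ _ (fun z : R * 'rV[R]_N => z.1 + s0) (@ln R)) => //.
  exact: continuous_ln.
have c5 : {for z, continuous (fun z : R * 'rV[R]_N =>
    c * ln (z.1 + s0) + A + sg * enorm (z.2 - x1))}.
  suff lim (F : set_system (R * 'rV[R]_N)) (f g : R * 'rV[R]_N -> R) (a b : R) : Filter F ->
      f @ F --> a -> g @ F --> b -> c * f w + A + sg * g w @[w --> F] --> c * a + A + sg * b.
    exact: lim.
  move=> FF Fa Fb; apply: cvgD.
    by apply: cvgD; [apply: cvgM => //|]; exact: cvg_cst.
  by apply: cvgM => //; exact: cvg_cst.
have c6 : {for z, continuous (fun z : R * 'rV[R]_N => power_profile (p - 2)^-1 D h
    (c * ln (z.1 + s0) + A + sg * enorm (z.2 - x1)))}.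
  apply: (@continuous_comp _ _ _ (fun z : R * 'rV[R]_N =>
    c * ln (z.1 + s0) + A + sg * enorm (z.2 - x1)) (power_profile (p - 2)^-1 D h)) => //.
  exact: continuous_power_profile.
suff lim (F : set_system (R * 'rV[R]_N)) (f g : R * 'rV[R]_N -> R) (a b : R) : Filter F ->
    f @ F --> a -> g @ F --> b -> f w * g w @[w --> F] --> a * b.
  exact: lim.
by move=> FF Fa Fb; exact: cvgM.
Qed.

End barriers.

Section comparison_with_barriers.
Context {R : realType} {N : nat}.
Implicit Types (p lam th d t : R) (x : 'rV[R]_N) (u : R -> 'rV[R]_N -> R).

(** The amplitude is governed by [th], between [1] and [lam]: the excess over [1]
    compensates the curvature at distances at least [r1] from the center. The
    hypothesis on [T] ensures that the barrier still vanishes in the ball of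
    radius [r1], where the curvature is not controlled. Where the barrier
    vanishes, it is at most [O(d ^+ 2)] nearby, hence has flat jets. *)
Lemma upper_barrier p u lam th d (x1 : 'rV[R]_N) (A r1 T rho : R) :
  let c := lam * (p - 2)^-1 in
  let Phi := barrier p c (th / (p - 1)) 1 A 1 (log_profile d) x1 in
  2 < p -> paraboloid_test p 1 u ->
  {within [set z : R * 'rV[R]_N | 0 <= z.1], continuous (fun z => u z.1 z.2)} ->
  0 < d -> 0 < th < lam -> (p - 1) * d <= (1 + (p - 2)^-1) * (lam - th) ->
  0 < r1 -> 1 <= th * (1 - (N%:R + p - 2) / r1) ->
  c * ln (T + 1) + A <= - r1 ->
  (forall x, `|x - x1| <= rho -> u 0 x <= Phi 0 x) ->
  (forall t x, 0 <= t < T -> `|x - x1| = rho -> u t x <= Phi t x) ->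
  forall t x, 0 <= t < T -> `|x - x1| <= rho -> u t x <= Phi t x.
Proof.
move=> c Phi p2 testu cu d0 /andP[th0 thlam] dsmall r10 thr1 AT init lateral.
have k0 : 0 < (p - 2)^-1 by rewrite invr_gt0 subr_gt0.
have p10 : 0 < p - 1 by rewrite subr_gt0 (lt_trans _ p2)// ltr1n.
have D0 : 0 < th / (p - 1) by rewrite divr_gt0.
have c0 : 0 < c by rewrite mulr_gt0// (lt_trans th0).
have nu0 : 0 <= N%:R + p - 2 by rewrite -addrA addr_ge0// subr_ge0 ltW.
suff le0 t x : 0 <= t < T -> `|x - x1| <= rho -> 1 * (u t x - Phi t x) <= 0.
  by move=> t x tT xr; have := le0 t x tT xr; rewrite mul1r subr_le0.
apply: (comparison (p := p)) => //; first by rewrite expr1n.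
- apply: continuous_barrier => //.
    by move=> y; exact: log_profile_ge0.
  exact: continuous_log_profile.
- by move=> z zr; rewrite mul1r subr_le0 init.
- by move=> s z sT zr; rewrite mul1r subr_le0 lateral.
move=> {}t {}x e /andP[t0 tT] xr _ e0.
have ts0 : 0 < t + 1 by rewrite addr_gt0.
set r := enorm (x - x1); pose y := c * ln (t + 1) + A + 1 * r.
have [y0|y0] := leP y 0.
  have G0 : power_profile (p - 2)^-1 (th / (p - 1)) (log_profile d) y = 0.
    by rewrite power_profile_eq0// log_profile_le0.
  set D := th / (p - 1) in D0 G0 *.
  apply: (@flat_jet _ _ _ _ _ _ _ _ _ _ (- (p - 2)^-1 * (t + 1) `^ (- (p - 2)^-1 - 1))
    (c / (t + 1)) (1 / d) (Num.min 1 (d / D))) => //.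
  - by rewrite expr1n.
  - by rewrite powR_gt0.
  - exact: quadratic_at_powR.
  - exact: quadratic_at_ln.
  - by rewrite lt_min ltr01 divr_gt0.
  - move=> z; rewrite lt_min => /andP[z1 zd]; rewrite -/y G0 subr0 mul1r.
    have z2 : z ^+ 2 <= `|z|.
      by rewrite -(real_normK (num_real z)) expr2 ler_piMr// ltW.
    have [yz0|yz0] := leP (y + z) 0.
      rewrite power_profile_eq0 ?log_profile_le0//.
      by rewrite mulr_ge0 ?sqr_ge0// divr_ge0// ltW.
    have yzz : y + z <= `|z|.
      by rewrite (le_trans _ (ler_norm z))// gerDr.
    have hz : log_profile d (y + z) <= z ^+ 2 / d.
      rewrite (le_trans (log_profile_le d0 yz0))// mulrA -expr2.
      have yz2 : (y + z) ^+ 2 <= z ^+ 2.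
        by rewrite -(real_normK (num_real z)) lerXn2r ?nnegrE ?(ltW yz0).
      have yzd : 0 < y + z + d by rewrite addr_gt0.
      apply: ler_pM => //; rewrite ?sqr_ge0 ?invr_ge0 ?(ltW yzd)//.
      by rewrite lef_pV2 ?posrE// lerDr ltW.
    rewrite /power_profile.
    have Dh1 : D * log_profile d (y + z) <= 1.
      rewrite mulrC -ler_pdivlMr// mul1r (le_trans hz)// ler_pdivrMr// mulrC.
      by rewrite (le_trans z2)// ltW.
    have Dh0 : 0 < D * log_profile d (y + z).
      by rewrite mulr_gt0// log_profile_gt0.
    rewrite ler_pdivrMr; last exact: (mulr_gt0 (addr_gt0 ltr01 k0) D0).
    apply: (@le_trans _ _ (D * log_profile d (y + z))).
      by rewrite ge1r_powR ?Dh0// lerDl ltW.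
    rewrite [leRHS](_ : _ = D * ((1 + (p - 2)^-1) * (z ^+ 2 / d))); last by rewrite /D; ring.
    rewrite ler_wpM2l ?(ltW D0)// (le_trans hz)// ler_peMl ?lerDl ?(ltW k0)//.
    by rewrite divr_ge0 ?sqr_ge0// ltW.
  - by rewrite -/y G0 !mulr0.
have lnT : ln (t + 1) <= ln (T + 1).
  by rewrite ler_ln ?posrE ?lerD2r ?(ltW tT)// (lt_trans ts0)// ltrD2r.
have r1r : r1 <= r.
  have := ler_wpM2l (ltW c0) lnT; move: y0 AT; rewrite /y mul1r.
  by clear; lra.
have r0 := lt_le_trans r10 r1r.
apply: (@barrier_smooth_jet _ _ _ _ _ _ _ _ _ (fun y => y / (y + d))
  (d / (y + d) ^+ 2)) => //.
- by rewrite expr1n.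
- exact: log_profile_gt0.
- by rewrite divr_gt0// addr_gt0.
- near=> z; apply: is_derive_log_profile => //.
  by near: z; exact: lt_nbhsr.
- exact: is_derive_log_slope.
rewrite mul1r; apply: log_profile_equation => //.
apply: (le_trans thr1); rewrite ler_wpM2l ?(ltW th0)// lerD2l lerN2.
by rewrite ler_wpM2l// lef_pV2.
Unshelve. all: by end_near. Qed.

(** The barrier starts with a support of radius [r1 + L] and varies only at
    distances between [r1] and [r1 + L] from its center, then farther and farther,
    so that the curvature is at most that of radius [r1]. On the plateau its jets
    are flat, and its time derivative is negative. *)
Lemma lower_barrier p u lam th (L : R) (x1 : 'rV[R]_N) (r1 s1 t1 T rho : R) :
  let c := lam * (p - 2)^-1 in
  let A := r1 + L - c * ln (t1 + s1) in
  let Phi := barrier p c (th / (p - 1)) s1 A (-1) (quad_profile L) x1 in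
  2 < p -> paraboloid_test p (-1) u ->
  {within [set z : R * 'rV[R]_N | 0 <= z.1], continuous (fun z => u z.1 z.2)} ->
  (forall t x, 0 <= t -> 0 <= u t x) ->
  0 < L -> 0 < lam < th -> 0 < r1 ->
  2 * (1 + (p - 2)^-1) * (p - 1) * lam <=
    (1 - lam / th) * (L * (1 - th * (1 + (N%:R + p - 2) / r1)) - th * (p - 1)) ->
  0 <= t1 -> 0 < t1 + s1 -> c * ln (T + s1) + A <= rho ->
  (forall x, `|x - x1| <= rho -> Phi t1 x <= u t1 x) ->
  forall t x, t1 <= t < T -> `|x - x1| <= rho -> Phi t x <= u t x.
Proof.
move=> c A Phi p2 testu cu u0 L0 /andP[lam0 lamth] r10 cond t10 t1s1 AT init.
have k0 : 0 < (p - 2)^-1 by rewrite invr_gt0 subr_gt0.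
have p10 : 0 < p - 1 by rewrite subr_gt0 (lt_trans _ p2)// ltr1n.
have th0 := lt_trans lam0 lamth.
have D0 : 0 < th / (p - 1) by rewrite divr_gt0.
have c0 : 0 < c by rewrite mulr_gt0.
have nu0 : 0 <= N%:R + p - 2 by rewrite -addrA addr_ge0// subr_ge0 ltW.
have lnt t : t1 <= t -> ln (t1 + s1) <= ln (t + s1).
  by move=> t1t; rewrite ler_ln ?posrE ?lerD2r// (lt_le_trans t1s1)// lerD2r.
suff le0 t x : t1 <= t < T -> `|x - x1| <= rho -> -1 * (u t x - Phi t x) <= 0.
  by move=> t x tT xr; have := le0 t x tT xr; rewrite mulN1r oppr_le0 subr_ge0.
apply: (comparison (p := p)) => //; first by rewrite sqrrN expr1n.
- apply: continuous_subspaceW cu => z /=; exact: le_trans.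
- apply: continuous_barrier => //.
    by move=> y; exact: quad_profile_ge0.
  exact: continuous_quad_profile.
- by move=> z zr; rewrite mulN1r oppr_le0 subr_ge0 init.
- move=> s z /andP[t1s sT] zr; rewrite mulN1r oppr_le0 subr_ge0.
  rewrite /Phi /barrier /radial power_profile_eq0 ?mulr0 ?u0 ?(le_trans t10)//.
  rewrite quad_profile_le0// mulN1r subr_le0.
  apply: le_trans (sup_norm_le_enorm _); rewrite zr (le_trans _ AT)// lerD2r.
  rewrite ler_wpM2l ?(ltW c0)// ler_ln ?posrE ?lerD2r ?(ltW sT)//.
    by rewrite (lt_le_trans t1s1)// lerD2r.
  by rewrite (lt_le_trans t1s1)// lerD2r (le_trans t1s)// ltW.
move=> {}t {}x e /andP[t1t tT] xr; rewrite mulN1r oppr_gt0 subr_lt0 => uPhi e0.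
have ts0 : 0 < t + s1 by rewrite (lt_trans t1s1)// ltrD2r.
set r := enorm (x - x1); pose y := c * ln (t + s1) + A + -1 * r.
have y0 : 0 < y.
  rewrite ltNge; apply/negP => y0; move: uPhi.
  rewrite /Phi /barrier /radial power_profile_eq0 ?quad_profile_le0// mulr0.
  by rewrite ltNge u0// (le_trans t10)// ltW.
have [Ly|yL] := leP L y.
  set D := th / (p - 1) in D0 *.
  have hL : 0 < L / 2 by rewrite divr_gt0.
  have G0 : power_profile (p - 2)^-1 D (quad_profile L) y =
      (D * (L / 2)) `^ (1 + (p - 2)^-1) / ((1 + (p - 2)^-1) * D).
    by rewrite /power_profile quad_profile_geL.
  pose m := 1 + (p - 2)^-1; have m1 : 1 <= m by rewrite lerDl ltW.
  have m0 : 0 < m by rewrite (lt_le_trans ltr01).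
  apply: (@flat_jet _ _ _ _ _ _ _ _ _ _ (- (p - 2)^-1 * (t + s1) `^ (- (p - 2)^-1 - 1))
    (c / (t + s1)) ((D * (L / 2)) `^ m / D / (L / 2) / (2 * L)) 1) => //.
  - by rewrite sqrrN expr1n.
  - by rewrite powR_gt0.
  - exact: quadratic_at_powR.
  - exact: quadratic_at_ln.
  - move=> z _; rewrite -/y mulN1r opprB G0 -/m.
    set v := quad_profile L (y + z).
    have v0 : 0 <= v := quad_profile_ge0 _ L0.
    have vflat : L / 2 - v <= z ^+ 2 / (2 * L) := quad_profile_flat _ L0 Ly.
    have bern := powR_ge_tangent m1 (divr_ge0 v0 (ltW hL)).
    rewrite /power_profile -/v -/m.
    have -> : (D * v) `^ m = (D * (L / 2)) `^ m * (v / (L / 2)) `^ m.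
      rewrite -powRM ?(divr_ge0 v0 (ltW hL)) ?(mulr_ge0 (ltW D0) (ltW hL))//.
      by congr (_ `^ _); field; rewrite gt_eqF.
    set B := (D * (L / 2)) `^ m.
    have B0 : 0 <= B by rewrite powR_ge0.
    apply: (@le_trans _ _ (B / D / (L / 2) * (L / 2 - v))); last first.
      rewrite [leRHS](_ : _ = B / D / (L / 2) * (z ^+ 2 / (2 * L)));
        last by rewrite mulrAC mulrA.
      rewrite ler_wpM2l//.
      exact: (divr_ge0 (divr_ge0 B0 (ltW D0)) (ltW hL)).
    rewrite [leLHS](_ : _ = B / (m * D) * (1 - (v / (L / 2)) `^ m));
      last by rewrite /B /D /m; ring.
    rewrite [leRHS](_ : _ = B / (m * D) * (m * (1 - v / (L / 2)))); last first.
      by clearbody B D m v; field; rewrite !gt_eqF.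
    apply: ler_wpM2l; first exact: (divr_ge0 B0 (mulr_ge0 (ltW m0) (ltW D0))).
    by move: bern; clear; lra.
  - rewrite -/y mulN1r !mulNr opprK mulr_ge0 ?power_profile_ge0//.
    by rewrite mulr_ge0 ?powR_ge0// ltW.
have r1r : r1 <= r.
  have := ler_wpM2l (ltW c0) (lnt t (ltW t1t)); move: yL; rewrite /y /A mulN1r.
  by clear; lra.
have r0 := lt_le_trans r10 r1r.
apply: (@barrier_smooth_jet _ _ _ _ _ _ _ _ _ (fun y => 1 - y / L) (- L^-1)) => //.
- by rewrite sqrrN expr1n.
- exact: quad_profile_gt0.
- by rewrite subr_gt0 ltr_pdivrMr// mul1r.
- near=> z; apply: is_derive_quad_profile; apply/andP; split; near: z.
    exact: lt_nbhsr.
  exact: lt_nbhsl.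
- exact: is_derive_quad_slope.
apply: (@quad_profile_equation _ _ _ _ _ _ r1) => //; rewrite ?y0 ?lam0//.
by rewrite r10.
Unshelve. all: by end_near. Qed.

End comparison_with_barriers.

(** * Propagation of the support *)

Section propagation.
Context {R : realType} {N : nat}.
Context (p : R) (u : R -> 'rV[R]_N -> R).
Context (p2 : 2 < p).
Context (cu :
  {within [set z : R * 'rV[R]_N | 0 <= z.1], continuous (fun z => u z.1 z.2)}).
Context (u_ge0 : forall (t : R) x, 0 <= t -> 0 <= u t x).
Implicit Types (x w : 'rV[R]_N) (t T M B lam : R).

Let k := (p - 2)^-1.
Let n := p - 1.
Let nu := N%:R + p - 2.

Let k_gt0 : 0 < k.
Proof. by rewrite invr_gt0 subr_gt0. Qed.

Let n_gt0 : 0 < n.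
Proof. by rewrite subr_gt0 (lt_trans _ p2)// ltr1n. Qed.

Let nu_gt0 : 0 < nu.
Proof. by rewrite /nu -addrA ltr_wpDl// subr_gt0. Qed.

Section upper.
Context (testu : paraboloid_test p 1 u).
Context (M R0 : R).
Context (uM : forall (t : R) x, 0 <= t -> u t x <= M).
Context (R0_gt0 : 0 < R0).
Context (u_init : forall x, R0 <= enorm x -> u 0 x = 0).

Let M_ge0 : 0 <= M.
Proof. exact: (le_trans (u_ge0 0 (lexx 0)) (uM 0 (lexx 0))). Qed.

Lemma power_log_profile_unbounded (D d : R) B : 0 < D -> 0 < d ->
  exists2 Y : R, 0 < Y & forall y, Y <= y -> B <= power_profile k D (log_profile d) y.
Proof.
move=> D0 d0; pose H := Num.max D^-1 ((1 + k) * B).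
have H0 : 0 < H by rewrite lt_max invr_gt0 D0.
exists (d + 2 * H) => [|y Yy]; first by rewrite addr_gt0// mulr_gt0.
have y0 : 0 < y by rewrite (lt_le_trans _ Yy)// addr_gt0// mulr_gt0.
have hH : H <= log_profile d y.
  apply: le_trans (log_profile_ge d0 y0).
  by rewrite ler_pdivlMr// mulrC lerBrDl.
have k1 : 0 < 1 + k by rewrite addr_gt0.
have D1 : 1 <= D * log_profile d y.
  by rewrite -ler_pdivrMl// mulr1 (le_trans _ hH)// le_max lexx.
rewrite /power_profile ler_pdivlMr ?mulr_gt0//.
apply: (@le_trans _ _ (D * log_profile d y)).
  rewrite mulrA [leRHS]mulrC ler_wpM2r ?(ltW D0)// mulrC (le_trans _ hH)//.
  by rewrite le_max lexx orbT.
by rewrite le1r_powR// lerDl ltW.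
Qed.

Let upper_constants lam : 1 < lam -> exists th d r1 : R,
  [/\ 0 < d, 0 < th < lam, n * d <= (1 + k) * (lam - th), 0 < r1 &
      1 <= th * (1 - nu / r1)].
Proof.
move=> lam1; pose th := (1 + lam) / 2.
have th1 : 1 < th by rewrite ltr_pdivlMr// mul1r; lra.
have thlam : th < lam by rewrite ltr_pdivrMr//; lra.
have th0 : 0 < th by rewrite (lt_trans ltr01).
have th1' : 0 < th - 1 by rewrite subr_gt0.
have k1 : 0 < 1 + k by rewrite addr_gt0.
exists th, ((1 + k) * (lam - th) / n), (nu * th / (th - 1)); split.
- by rewrite divr_gt0// mulr_gt0// subr_gt0.
- by rewrite th0.
- by rewrite mulrC divfK// gt_eqF.
- by rewrite divr_gt0// mulr_gt0.
- rewrite le_eqVlt; apply/orP; left; apply/eqP.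
  by field; rewrite !gt_eqF.
Qed.

(** A barrier centered at [x] that vanishes around [x], and exceeds [M] at a
    fixed distance from [x], prevents [u] from reaching [x] before [T] if [u 0]
    is [0] up to this distance. *)
Lemma finite_propagation T : 0 <= T -> exists2 X : R, 0 < X &
  forall t x, 0 <= t < T -> X <= enorm x -> u t x = 0.
Proof.
move=> T0; have lam1 : 1 < 2 :> R by rewrite ltr1n.
have [th [d [r1 [d0 /andP[th0 thlam] dsmall r10 thr1]]]] := upper_constants lam1.
set lam : R := 2 in lam1 thlam dsmall.
pose c := lam * k; have c0 : 0 < c by rewrite mulr_gt0// (lt_trans th0).
have D0 : 0 < th / n by rewrite divr_gt0.
have T1 : 0 < T + 1 by rewrite ltr_wpDl.
pose Pm := (T + 1) `^ (- k); have Pm0 : 0 < Pm by rewrite powR_gt0.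
have [Y Y0 GY] := power_log_profile_unbounded (M / Pm) D0 d0.
pose a := r1 + c * ln (T + 1).
have a0 : 0 < a by rewrite ltr_wpDr// mulr_ge0 ?(ltW c0)// ln_ge0// lerDr.
pose rho := a + Y; have rho0 : 0 < rho by rewrite addr_gt0.
exists (R0 + N%:R * rho); first by rewrite ltr_pwDl// mulr_ge0// ltW.
move=> t x tT xX; have t0 : 0 <= t by case/andP: tT.
apply/eqP; rewrite eq_le u_ge0// andbT.
have AT : c * ln (T + 1) + - a <= - r1 by rewrite /a; lra.
have xx : `|x - x| <= rho by rewrite subrr normr0 ltW.
have lnt s : 0 <= s -> 0 <= c * ln (s + 1).
  by move=> s0; rewrite mulr_ge0 ?(ltW c0)// ln_ge0// lerDr.
have thl : 0 < th < lam by rewrite th0.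
apply: (le_trans (upper_barrier (A := - a) (x1 := x) p2 testu cu d0 thl dsmall r10
  thr1 AT _ _ tT xx)).
- move=> z zr; rewrite u_init.
    by rewrite mulr_ge0 ?powR_ge0// power_profile_ge0.
  have := enorm_lip x z; have := enorm_le_sup_norm (x - z); rewrite distrC in zr.
  have : N%:R * `|x - z| <= N%:R * rho by rewrite ler_wpM2l.
  move: xX; rewrite ler_norml; lra.
- move=> s z /andP[s0 sT] zr; apply: (le_trans (uM z s0)).
  rewrite /barrier /radial -/k mul1r.
  apply: (@le_trans _ _ (Pm * (M / Pm))).
    by rewrite mulrC divfK// gt_eqF.
  have s1 : 0 < s + 1 by rewrite ltr_wpDl.
  rewrite ler_pM ?(ltW Pm0) ?divr_ge0 ?(ltW Pm0)//.
    rewrite /Pm !powRN lef_pV2 ?posrE ?powR_gt0// ge0_ler_powR ?nnegrE ?(ltW k_gt0)//.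
    - exact: ltW.
    - exact: ltW.
    - by rewrite lerD2r ltW.
  apply: GY; have := sup_norm_le_enorm (z - x); rewrite zr /rho.
  by have := lnt s s0; rewrite -/c; lra.
rewrite /barrier /radial power_profile_eq0 ?mulr0// log_profile_le0//.
rewrite subrr enorm0 mulr0 addr0 (le_trans _ (_ : - r1 <= 0)) ?oppr_le0 ?(ltW r10)//.
apply: (le_trans _ AT); rewrite lerD2r ler_wpM2l ?(ltW c0)//.
by rewrite ler_ln ?posrE ?lerD2r ?ltr_wpDl//; case/andP: tT => _ /ltW.
Qed.

(** The center of the barrier is sent to infinity in the direction of [x]: its
    front is then almost a hyperplane, and at time [0] it only has to pass
    beyond the support of [u 0]. *)
Lemma support_growth lam : 1 < lam -> exists2 Y : R, 0 < Y & forall t x, 0 <= t ->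
  Y + lam * k * ln (t + 1) <= enorm x -> u t x = 0.
Proof.
move=> lam1.
have [th [d [r1 [d0 thlam dsmall r10 thr1]]]] := upper_constants lam1.
have th0 : 0 < th by case/andP: thlam.
pose c := lam * k; have c0 : 0 < c by rewrite mulr_gt0// (lt_trans ltr01).
have D0 : 0 < th / n by rewrite divr_gt0.
have [Y Y0 GY] := power_log_profile_unbounded M D0 d0.
exists (R0 + Y) => [|t x t0 xY]; first by rewrite addr_gt0.
have t1 : 0 < t + 1 by rewrite ltr_wpDl.
have T0 : 0 <= t + 1 by rewrite ltW.
have [X X0 uX] := finite_propagation T0.
have lnT0 : 0 <= c * ln (t + 1 + 1).
  by rewrite mulr_ge0 ?(ltW c0)// ln_ge0// lerDr.
have lnt0 : 0 <= c * ln (t + 1).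
  by rewrite mulr_ge0 ?(ltW c0)// ln_ge0// lerDr.
pose r := enorm x; have r0 : 0 < r.
  by rewrite (lt_le_trans _ xY)// ltr_wpDr// addr_gt0.
(* The distance of the center to the origin; x is on the way to it. *)
pose H := R0 + Y + r1 + c * ln (t + 1 + 1) + r.
have H0 : 0 < H by rewrite /H ltr_wpDl ?(ltW r0)// ?addr_ge0 ?(ltW R0_gt0) ?(ltW Y0) ?(ltW r10).
pose x1 := (H / r) *: x.
have x1H : enorm x1 = H.
  by rewrite enormZ ger0_norm ?divr_ge0 ?(ltW H0) ?(ltW r0)// -/r divfK// gt_eqF.
have xx1 : enorm (x - x1) = H - r.
  rewrite -[X in X - x1]scale1r -scalerBl enormZ -normrN opprB ger0_norm.
    by rewrite mulrBl mul1r divfK// gt_eqF.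
  by rewrite subr_ge0 ler_pdivlMr// mul1r /H; move: R0_gt0 Y0 r10 lnT0; lra.
pose A := - (H - R0 - Y).
have AT : c * ln (t + 1 + 1) + A <= - r1 by rewrite /A /H; move: r0; lra.
pose rho := H + X.
have tT : 0 <= t < t + 1 by rewrite t0 ltrDl ltr01.
have xrho : `|x - x1| <= rho.
  by rewrite (le_trans (sup_norm_le_enorm _))// xx1 /rho; move: r0 X0; lra.
apply/eqP; rewrite eq_le u_ge0// andbT.
apply: (le_trans (upper_barrier (A := A) (x1 := x1) p2 testu cu d0 thlam dsmall r10
  thr1 AT _ _ tT xrho)).
- move=> z _; have [zR|zR] := leP R0 (enorm z).
    by rewrite u_init// mulr_ge0 ?powR_ge0// power_profile_ge0.
  apply: (le_trans (uM z (lexx 0))).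
  rewrite /barrier /radial add0r ln1 powR1 mulr0 add0r !mul1r; apply: GY.
  have := enorm_lip x1 z; rewrite x1H -(enormN (x1 - z)) opprB ler_norml.
  by rewrite /A; move: zR; lra.
- move=> s z sT zr; rewrite uX//.
    by rewrite mulr_ge0 ?powR_ge0// power_profile_ge0.
  rewrite (le_trans _ (sup_norm_le_enorm z))//.
  have := ler_normB z x1; have := sup_norm_le_enorm x1.
  by rewrite zr x1H /rho; lra.
rewrite /barrier /radial power_profile_eq0 ?mulr0// log_profile_le0//.
by rewrite xx1 mul1r -/c /A; move: xY; rewrite -/c -/r; lra.
Qed.

End upper.

Section lower.
Context (testu : paraboloid_test p (-1) u).

(** How small [u] is on the initial ball does not matter: starting the clock of
    the barrier at the time [tau] makes its amplitude [tau `^ (- k)] as small as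
    needed, without any effect on its support. *)
Lemma positivity_spreads lam (th L r1 t1 : R) (x1 : 'rV[R]_N) :
  0 < L -> 0 < lam < th -> 0 < r1 ->
  2 * (1 + k) * n * lam <=
    (1 - lam / th) * (L * (1 - th * (1 + nu / r1)) - th * n) ->
  0 <= t1 -> (forall x, `|x - x1| <= r1 + L -> 0 < u t1 x) ->
  exists2 tau : R, 0 < tau & forall t x, t1 <= t ->
    enorm (x - x1) < r1 + L + lam * k * ln ((t - t1 + tau) / tau) -> 0 < u t x.
Proof.
move=> L0 lamth r10 cond t10 upos.
have lam0 : 0 < lam by case/andP: lamth.
have th0 : 0 < th by case/andP: lamth => _; exact: lt_trans.
pose c := lam * k; have c0 : 0 < c by rewrite mulr_gt0.
pose D := th / n; have D0 : 0 < D by rewrite divr_gt0.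
have rL0 : 0 < r1 + L by rewrite addr_gt0.
have [eps eps0 ueps] : exists2 eps : R, 0 < eps &
    forall x, `|x - x1| <= r1 + L -> eps <= u t1 x.
  have Q0 : (`[t1, t1]%classic `*` [set x | `|x - x1| <= r1 + L]) !=set0.
    by exists (t1, x1); split; rewrite /= ?in_itv /= ?lexx// subrr normr0 ltW.
  have cQ : {within `[t1, t1]%classic `*` [set x | `|x - x1| <= r1 + L],
      continuous (fun z : R * 'rV[R]_N => u z.1 z.2)}.
    apply: continuous_subspaceW cu => z [/= + _]; rewrite in_itv /= => /andP[+ _].
    exact: le_trans.
  have [[s y]] := compact_EVT_min Q0 (@compact_cylinder _ _ t1 t1 x1 (r1 + L)) cQ.
  rewrite inE => -[/=]; rewrite in_itv /= -eq_le => /eqP <- yr umin.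
  exists (u t1 y); first exact: upos.
  move=> x xr; apply: (umin (t1, x)); rewrite inE; split => //=.
  by rewrite in_itv /= lexx.
pose G := power_profile k D (quad_profile L).
have GL0 : 0 < G L by rewrite power_profile_gt0// quad_profile_gt0.
have Gmax y : G y <= G L.
  apply: power_profile_homo => //; first exact: quad_profile_ge0.
  by rewrite (quad_profile_geL L0 (lexx L)) quad_profile_max.
pose tau := (G L / eps) `^ (p - 2).
have tau0 : 0 < tau by rewrite powR_gt0// divr_gt0.
have tauk : tau `^ (- k) = eps / G L.
  rewrite /tau -powRrM mulrN mulfV ?gt_eqF ?subr_gt0//.
  by rewrite powR_inv1 ?invf_div// divr_ge0// ltW.
exists tau => // t x t1t xt.
pose s1 := tau - t1.
have t1s1 : t1 + s1 = tau by rewrite /s1 addrC subrK.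
have t1s1_gt0 : 0 < t1 + s1 by rewrite t1s1.
have ts1 : t + s1 = t - t1 + tau by rewrite /s1; ring.
pose A := r1 + L - c * ln (t1 + s1).
pose rho := c * ln (t + 1 + s1) + A.
have tt1 : t1 <= t < t + 1 by rewrite t1t ltrDl ltr01.
have ts0 : 0 < t + s1 by rewrite ts1 ltr_wpDl// subr_ge0.
have yE : c * ln (t + s1) + A = r1 + L + c * ln ((t - t1 + tau) / tau).
  by rewrite ln_div ?posrE -?ts1// /A t1s1; ring.
have xrho : `|x - x1| <= rho.
  rewrite (le_trans (sup_norm_le_enorm _))// (le_trans (ltW xt))// -yE /rho lerD2r.
  rewrite ler_wpM2l ?(ltW c0)// ler_ln ?posrE// addrAC ?lerDl//.
  by rewrite addr_gt0.
apply: (lt_le_trans _ (lower_barrier (th := th) (L := L) (r1 := r1) (s1 := s1)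
  (rho := rho) p2 testu cu u_ge0 L0 lamth r10 cond t10 t1s1_gt0 (lexx _) _ tt1 xrho)).
  rewrite mulr_gt0 ?powR_gt0// power_profile_gt0// quad_profile_gt0//.
  by rewrite mulN1r subr_gt0 yE.
move=> z _; have [zr|zr] := leP (enorm (z - x1)) (r1 + L).
  apply: (le_trans _ (ueps z _)); last first.
    by rewrite (le_trans (sup_norm_le_enorm _)).
  by rewrite /barrier /radial t1s1 tauk mulrAC ler_pdivrMr// ler_wpM2l ?(ltW eps0)//.
rewrite /barrier /radial power_profile_eq0 ?mulr0 ?u_ge0// quad_profile_le0//.
by rewrite mulN1r /A -/c; move: zr; lra.
Qed.

Context (u0_neq0 : exists x, 0 < u 0 x).

(** The initial positivity set may be tiny, with a large curvature. The condition
    on the constants then still holds for [th] and [lam] small; the growth is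
    slow, but unbounded. *)
Lemma positivity_reaches_ball rho : exists2 t : R, 0 <= t &
  forall x, `|x| <= rho -> 0 < u t x.
Proof.
have [x1 ux1] := u0_neq0.
have [e e0 ue] : exists2 e : R, 0 < e & forall x, `|x - x1| < e -> 0 < u 0 x.
  have /subspace_continuousP/(_ (0, x1) (lexx 0)) cu0 := cu.
  have : \forall z \near ((0 : R), x1), 0 <= z.1 -> 0 < u z.1 z.2.
    exact: (@cvgr_gt _ _ _ (within_filter _ _) _ _ cu0 0 ux1).
  move=> /nbhs_ballP[e /= e0 ue]; exists e => // x xe.
  apply: (ue (0, x)) => //=; split; first exact: ballxx.
  by rewrite -ball_normE /= distrC.
pose L := e / 4; have L0 : 0 < L by rewrite divr_gt0.
pose b := 2 * (1 + k) * n + L * (1 + nu / L) + n.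
have k1 : 0 < 1 + k by rewrite addr_gt0.
have b0 : 0 < b.
  rewrite addr_gt0// addr_gt0 ?mulr_gt0// addr_gt0// divr_gt0//.
pose th := L / b; have th0 : 0 < th by rewrite divr_gt0.
have lamth : 0 < th / 2 < th by rewrite divr_gt0//= ltr_pdivrMr// ltr_pMr// ltr1n.
have cond : 2 * (1 + k) * n * (th / 2) <=
    (1 - (th / 2) / th) * (L * (1 - th * (1 + nu / L)) - th * n).
  have -> : th / 2 / th = 2^-1 by field; rewrite gt_eqF.
  rewrite le_eqVlt; apply/orP; left.
  rewrite -subr_eq0 (_ : _ - _ = (th * b - L) / 2); last by rewrite /b; field; rewrite gt_eqF.
  by rewrite /th divfK ?subrr ?mul0r// gt_eqF.
have upos x : `|x - x1| <= L + L -> 0 < u 0 x.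
  move=> xL; apply: ue; apply: (le_lt_trans xL).
  by rewrite /L; move: e0; lra.
have [tau tau0 spread] := positivity_spreads L0 lamth L0 cond (lexx 0) upos.
pose c := th / 2 * k; have c0 : 0 < c by rewrite mulr_gt0// divr_gt0.
pose B := N%:R * rho + enorm x1.
exists (tau * expR (B / c)); first by rewrite mulr_ge0 ?expR_ge0// ltW.
move=> x xrho; apply: spread; first by rewrite mulr_ge0 ?expR_ge0// ltW.
have lnB : B / c <= ln ((tau * expR (B / c) - 0 + tau) / tau).
  rewrite -[leLHS]expRK ler_ln ?posrE ?expR_gt0//.
    by rewrite subr0 ler_pdivlMr// mulrC lerDl ltW.
  by rewrite divr_gt0// subr0 addr_gt0// mulr_gt0// expR_gt0.
apply: (@le_lt_trans _ _ B).
  rewrite (le_trans (enormD _ _))// enormN lerD2r.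
  by rewrite (le_trans (enorm_le_sup_norm _))// ler_wpM2l.
apply: (@le_lt_trans _ _ (c * ln ((tau * expR (B / c) - 0 + tau) / tau))).
  by rewrite mulrC -ler_pdivrMr.
by rewrite ltrDr addr_gt0.
Qed.

(** On a large ball, [L] and [r1] can be large, and the condition on the constants
    becomes [th < 1]. *)
Lemma positivity_growth lam : 0 < lam < 1 -> exists t1 tau : R,
  [/\ 0 <= t1, 0 < tau & forall t x, t1 <= t ->
    enorm x <= lam * k * ln ((t - t1 + tau) / tau) -> 0 < u t x].
Proof.
move=> /andP[lam0 lam1].
pose th := (1 + lam) / 2.
have th1 : th < 1 by rewrite ltr_pdivrMr//; lra.
have lamth : lam < th by rewrite ltr_pdivlMr//; lra.
have th0 : 0 < th by rewrite (lt_trans lam0).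
have q0 : 0 < 1 - lam / th by rewrite subr_gt0 ltr_pdivrMr// mul1r.
have k1 : 0 < 1 + k by rewrite addr_gt0.
have th1' : 0 < 1 - th by rewrite subr_gt0.
pose L := (2 * (1 + k) * n * lam / (1 - lam / th) + th * nu + th * n) / (1 - th).
have L0 : 0 < L.
  have a1 : 0 < 2 * (1 + k) * n * lam by rewrite !mulr_gt0.
  exact: (divr_gt0 (addr_gt0 (addr_gt0 (divr_gt0 a1 q0) (mulr_gt0 th0 nu_gt0))
    (mulr_gt0 th0 n_gt0)) th1').
have lamth' : 0 < lam < th by rewrite lam0.
have cond : 2 * (1 + k) * n * lam <=
    (1 - lam / th) * (L * (1 - th * (1 + nu / L)) - th * n).
  rewrite le_eqVlt; apply/orP; left; apply/eqP.
  have LE : L * (1 - th) = 2 * (1 + k) * n * lam / (1 - lam / th) + th * nu + th * n.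
    by rewrite /L divfK// gt_eqF.
  have -> : L * (1 - th * (1 + nu / L)) - th * n =
      2 * (1 + k) * n * lam / (1 - lam / th).
    transitivity (L * (1 - th) - th * nu - th * n); first by field; rewrite gt_eqF.
    by rewrite LE addrAC !addrK.
  by rewrite [RHS]mulrC divfK// gt_eqF.
have [t1 t10 ut1] := positivity_reaches_ball (L + L).
have upos x : `|x - 0| <= L + L -> 0 < u t1 x by rewrite subr0; exact: ut1.
have [tau tau0 spread] := positivity_spreads L0 lamth' L0 cond t10 upos.
exists t1, tau; split => // t x t1t xt; apply: spread => //.
by rewrite subr0 (le_lt_trans xt)// ltrDr addr_gt0.
Qed.

End lower.
End propagation.

(** * From the bounds to the speed *)

Section limit.
Context {R : realType}.

(** The shifts of [t] and the factor [tau] only change the logarithms by bounded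
    amounts. *)
Lemma ln_ratio_cvg (f : R -> R) (k : R) : 0 < k ->
  (forall lam, 1 < lam -> exists Y : R, \forall t \near +oo,
    f t <= Y + lam * k * ln (t + 1)) ->
  (forall lam, 0 < lam < 1 -> exists t1 tau : R, 0 < tau /\ \forall t \near +oo,
    lam * k * ln ((t - t1 + tau) / tau) <= f t) ->
  f t / ln t @[t --> +oo] --> k.
Proof.
move=> k0 upper lower; apply/cvgrPdist_le => e e0.
have lny (B : R) : \forall t \near +oo, B <= ln t.
  exists (expR B); split; first by rewrite num_real.
  move=> t Bt; have t0 : 0 < t := lt_trans (expR_gt0 B) Bt.
  by rewrite -[B]expRK ler_ln ?posrE ?expR_gt0// ltW.
pose d := e / 2 / k; have d0 : 0 < d by do 2 apply: divr_gt0 => //.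
have dk : d * k = e / 2 by rewrite /d divfK// gt_eqF.
have [Y fY] : exists Y : R, \forall t \near +oo,
    f t <= Y + (1 + d) * k * ln (t + 1) by apply: upper; rewrite ltrDl.
pose lam := Num.max 2^-1 (1 - d).
have lam01 : 0 < lam < 1.
  by rewrite lt_max invr_gt0 ltr0n/= gt_max invf_lt1// ltr1n/= gtrBl.
have lamd : 1 - d <= lam by rewrite le_max lexx orbT.
have [t1 [tau [tau0 ftau]]] := lower lam lam01.
have lam0 : 0 < lam by case/andP: lam01.
near=> t.
have t1' : 1 <= t by near: t; exact: nbhs_pinfty_ge.
have tt1 : 2 * t1 <= t.
  by near: t; apply: nbhs_pinfty_ge; rewrite num_real.
have t0 : 0 < t by rewrite (lt_le_trans ltr01).
have lnt1 : 1 <= ln t by near: t.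
have lnt0 : 0 < ln t by rewrite (lt_le_trans ltr01).
have up : f t <= Y + (1 + d) * k * ln (t + 1) by near: t.
have low : lam * k * ln ((t - t1 + tau) / tau) <= f t by near: t.
have e2 : 0 < e / 2 by rewrite divr_gt0.
have bigY : Y + (1 + d) * k * ln 2 <= e / 2 * ln t.
  by rewrite -ler_pdivrMl//; near: t; exact: lny.
have bigtau : lam * k * ln (2 * tau) <= e / 2 * ln t.
  by rewrite -ler_pdivrMl//; near: t; exact: lny.
rewrite distrC ler_norml; apply/andP; split.
  rewrite lerBrDr ler_pdivlMr// (le_trans _ low)//.
  have : ln t - ln (2 * tau) <= ln ((t - t1 + tau) / tau).
    rewrite -ln_div ?posrE ?mulr_gt0// ler_ln ?posrE ?divr_gt0 ?mulr_gt0//.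
      by rewrite invfM mulrA ler_pM2r ?invr_gt0//; lra.
    by lra.
  move=> /(ler_wpM2l (ltW (mulr_gt0 lam0 k0))); apply: le_trans; rewrite [leRHS]mulrBr.
  have : (1 - d) * k * ln t <= lam * k * ln t.
    by rewrite ler_wpM2r ?(ltW lnt0)// ler_wpM2r ?(ltW k0).
  by rewrite mulrBl mul1r dk; lra.
rewrite lerBlDr ler_pdivrMr// (le_trans up)//.
have : ln (t + 1) <= ln 2 + ln t.
  by rewrite -lnM ?posrE// ler_ln ?posrE ?mulr_gt0 ?addr_gt0//; lra.
have dk0 : 0 < (1 + d) * k by rewrite mulr_gt0// addr_gt0.
move=> /(ler_wpM2l (ltW dk0)); rewrite [leRHS]mulrDr => h.
have : (1 + d) * k = k + e / 2 by rewrite mulrDl mul1r dk.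
move=> dkE; move: h bigY; rewrite dkE; lra.
Unshelve. all: by end_near. Qed.

Lemma sup_between (S : set R) (B U : R) : 0 < B ->
  (forall s, 0 <= s < B -> S s) -> (forall s, S s -> s <= U) -> B <= sup S <= U.
Proof.
move=> B0 SB SU.
have S0 : S 0 by apply: SB; rewrite lexx.
have hs : has_sup S by split; [exists 0|exists U].
apply/andP; split; last by apply: ge_sup => //; exists 0.
rewrite leNgt; apply/negP => supB.
have sup0 : 0 <= sup S by apply: ub_le_sup => //; exists U.
have : S ((sup S + B) / 2).
  by apply: SB; rewrite divr_ge0 ?addr_ge0 ?(ltW B0)//= ltr_pdivrMr//; lra.
by move=> /(ub_le_sup (proj2 hs)); rewrite ler_pdivrMr//; lra.
Qed.

End limit.

Theorem theorem1p2 (R : realType) (N : nat) (p R0 : R) (u0 : 'rV[R]_N -> R)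
    (u : R -> 'rV[R]_N -> R) :
  (1 <= N)%N -> 2 < p ->
  W1infty u0 -> (forall x, 0 <= u0 x) -> (exists x, u0 x != 0) ->
  0 < R0 -> supp u0 `<=` [set x | enorm x < R0] ->
  cauchy_solution p u0 u ->
  (gamma u t / ln t @[t --> +oo] --> (p - 2)^-1) /\
  (forall w : 'rV[R]_N, enorm w = 1 ->
     gamma_dir u w t / ln t @[t --> +oo] --> (p - 2)^-1).
Proof.
move=> N1 p2 _ u0_ge0 [x0 ux0] R0_gt0 supp_u0.
move=> [[[cu [M uM]] _] u_ge0 [sub super] uinit].
have k0 : 0 < (p - 2)^-1 by rewrite invr_gt0 subr_gt0.
have u_le t x : 0 <= t -> u t x <= M.
  by move=> t0; rewrite (le_trans (ler_norm _))// uM.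
have u_init x : R0 <= enorm x -> u 0 x = 0.
  rewrite uinit => xR; apply/eqP/negPn/negP => ux.
  have /supp_u0 : supp u0 x by apply: subset_closure.
  by rewrite /= ltNge xR.
have u0_gt0 : exists x, 0 < u 0 x by exists x0; rewrite uinit lt0r ux0 u0_ge0.
have upper := support_growth p2 cu u_ge0 (subsolution_test p2 sub) u_le R0_gt0 u_init.
have lower := positivity_growth p2 cu u_ge0 (supersolution_test p2 super) u0_gt0.
(* Both free boundaries are the supremum of a set that contains an interval
   [0, B[ and is bounded by U, with B and U as in the two bounds above. *)
have speed (S : R -> set R) :
    (forall t B, 0 <= t -> (forall x, enorm x < B -> 0 < u t x) ->
      forall s, 0 <= s < B -> S t s) ->
    (forall t U, 0 <= t -> (forall x, 0 < u t x -> enorm x <= U) ->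
      forall s, S t s -> s <= U) ->
    sup (S t) / ln t @[t --> +oo] --> (p - 2)^-1.
  move=> SB SU.
  have between t B U : 0 < B -> 0 <= t -> (forall x, enorm x < B -> 0 < u t x) ->
      (forall x, 0 < u t x -> enorm x <= U) -> B <= sup (S t) <= U.
    by move=> B0 t0 uB uU; apply: sup_between => //; [exact: SB|exact: SU].
  have supp_le lam : 1 < lam -> exists Y : R, forall t x, 0 <= t -> 0 < u t x ->
      enorm x <= Y + lam * (p - 2)^-1 * ln (t + 1).
    move=> /upper[Y _ uY]; exists Y => t x t0 ux; rewrite leNgt; apply/negP => xY.
    by rewrite (uY t x t0 (ltW xY)) ltxx in ux.
  have pos_ge lam : 0 < lam < 1 -> exists t1 tau : R, [/\ 0 <= t1, 0 < tau,
      forall t, t1 < t -> 0 < lam * (p - 2)^-1 * ln ((t - t1 + tau) / tau) &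
      forall t x, t1 < t -> enorm x < lam * (p - 2)^-1 * ln ((t - t1 + tau) / tau) ->
      0 < u t x].
    move=> lam01; have [t1 [tau [t10 tau0 ut]]] := lower lam lam01.
    exists t1, tau; split => // [t t1t|t x t1t xB]; last first.
      by apply: ut; rewrite ltW.
    rewrite mulr_gt0 ?mulr_gt0//; first by case/andP: lam01.
    by rewrite ln_gt0// ltr_pdivlMr// mul1r ltrDr subr_gt0.
  have half : 0 < (2^-1 : R) < 1 by rewrite invr_gt0 ltr0n/= invf_lt1// ltr1n.
  apply: ln_ratio_cvg => // [lam lam1|lam lam01].
  - have [Y uY] := supp_le lam lam1; exists Y.
    have [t1 [tau [t10 tau0 B0 ut]]] := pos_ge _ half.
    near=> t; have t1t : t1 < t by near: t; apply: nbhs_pinfty_gt; rewrite num_real.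
    have t0 : 0 <= t := ltW (le_lt_trans t10 t1t).
    by have /andP[] := between t _ _ (B0 t t1t) t0 (fun x => ut t x t1t) (uY t ^~ t0).
  - have [t1 [tau [t10 tau0 B0 ut]]] := pos_ge _ lam01.
    exists t1, tau; split => //.
    have [Y uY] := supp_le 2 (ltr1n _ 2).
    near=> t; have t1t : t1 < t by near: t; apply: nbhs_pinfty_gt; rewrite num_real.
    have t0 : 0 <= t := ltW (le_lt_trans t10 t1t).
    by have /andP[] := between t _ _ (B0 t t1t) t0 (fun x => ut t x t1t) (uY t ^~ t0).
split=> [|w w1]; apply: speed => t.
- move=> B t0 uB s /andP[s0 sB] /=; exists (s *: delta_mx ord0 (Ordinal N1)).
    apply: uB; rewrite enormZ ger0_norm//.
    by rewrite enormE dot_delta mxE !eqxx sqrtr1 mulr1.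
  by rewrite enormZ ger0_norm// enormE dot_delta mxE !eqxx sqrtr1 mulr1.
- by move=> U t0 uU _ [x ux <-]; exact: uU.
- move=> B t0 uB s /andP[s0 sB]; split => //; apply: uB.
  by rewrite enormZ w1 mulr1 ger0_norm.
- move=> U t0 uU s [s0 us]; have := uU _ us.
  by rewrite enormZ w1 mulr1 ger0_norm.
Unshelve. all: by end_near. Qed.
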